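(* Let $p$ be a path in $K\Gamma$ starting in the vertex $e(1)$. (I) There is a surjective map $\Phi_p$ from the variety $V_p$ to the set of isomorphism types of uniserial left $\Lambda$-modules with mast $p$. It assigns to each point $k=\bigl(k_i(\alpha,u)\bigr)_{i\in I(\alpha,u),\ (\alpha,u)\wr\wr p}$ in $V_p$ the isomorphism type of the module $\Lambda e(1)/U_k$, where $$U_k=\Biggl(\sum_{(\alpha,u)\wr\wr p}\Lambda\Bigl(\alpha u-\sum_{i\in I(\alpha,u)}k_i(\alpha,u)\,v_i(\alpha,u)\Bigr)\Biggr)+\Biggl(\sum_{q\ \text{a path that is not a route on}\ p}\Lambda q e(1)\Biggr).$$ Alternately, the uniserial module $\Lambda e(1)/U_k$ representing $\Phi_p(k)$ can be described as the unique uniserial factor module with mast $p$ of the module $$\Lambda e(1)\Big/\Biggl(\sum_{(\alpha,u)\wr\wr p}\Lambda\Bigl(\alpha u-\sum_{i\in I(\alpha,u)}k_i(\alpha,u)\,v_i(\alpha,u)\Bigr)\Biggr).$$ (II) The variety $V_p$ is nonempty if and only if there exists a uniserial left $\Lambda$-module with mast $p$. (III) Provided that $p$ does not have a proper right subpath which is an oriented cycle of positive length, the map $\Phi_p$ is bijective. More strongly: if $p$ is not of the form $p'c$, where $c$ is an oriented cycle and both $p'$ and $c$ are paths of positive length, then $\Phi_p$ is bijective.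
   Context: Setting. $K$ is an arbitrary field, $\Gamma$ a finite quiver, $I$ an admissible ideal of the path algebra $K\Gamma$, and $\Lambda=K\Gamma/I$, a finite dimensional algebra with Jacobson radical $J$ and Loewy length $L$ (the least integer with $J^L=0$). Vertices of $\Gamma$ are identified with the corresponding primitive idempotents (paths of length $0$). The product $qp$ of paths means ''$q$ after $p$'' (and is $0$ if this is not defined). Modules are left modules. A path of $K\Gamma$ and its residue class in $\Lambda$ are denoted by the same symbol. Right subpaths. A path $v$ is a right subpath of $p$ if $p=wv$ for some path $w$ (lengths $0$ allowed); it is proper if it is strictly shorter than $p$. Masts. A mast of a uniserial $\Lambda$-module $U$ of composition length $l+1$ is a path $p$ of length $l$ in $K\Gamma$ with $pU\neq0$. Detours. A detour on a path $p$ is a pair $(\alpha,u)$, where $\alpha$ is an arrow and $u$ is a right subpath of $p$ (length $0$ allowed) such that (i) $\alpha u\ne0$ in $K\Gamma$; (ii) $\alpha u$ is not a right subpath of $p$; (iii) there is a right subpath $v$ of $p$ with $\mathrm{length}(v)\ge\mathrm{length}(u)+1$ whose endpoint equals the endpoint of $\alpha$. One writes $(\alpha,u)\wr\wr p$. For a detour $(\alpha,u)$ on $p$, $\{v_i(\alpha,u)\mid i\in I(\alpha,u)\}$ is the family (indexed without repetition by the finite set $I(\alpha,u)$) of all right subpaths of $p$ that are longer than $u$ and have the same endpoint as $\alpha$. Routes. If $p$ passes consecutively through the vertices $e(1),\dots,e(l+1)$, a route on $p$ is a path in $K\Gamma$ (possibly $e(1)$ itself) which starts in $e(1)$ and whose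 sequence of consecutive vertices is a subsequence of $(e(1),\dots,e(l+1))$. The variety $V_p$. Let $X$ be the family of independent commuting variables $X_i(\alpha,u)$, $(\alpha,u)\wr\wr p$, $i\in I(\alpha,u)$, let $K[X]$ be the polynomial ring over $K$ and $K\Gamma[X]$ the polynomial ring with coefficients in $K\Gamma$. Let $\mathcal L(p)$ be the left ideal of $K\Gamma[X]$ generated by all paths that are not routes on $p$ together with all differences $\alpha u-\sum_{i\in I(\alpha,u)}X_i(\alpha,u)v_i(\alpha,u)$ for $(\alpha,u)\wr\wr p$. Each $z\in K\Gamma$ is congruent modulo $\mathcal L(p)$ to a unique element $\sum_{p'}\tau_{p'}(X)p'$ with $\tau_{p'}(X)\in K[X]$, where $p'$ runs through the right subpaths of $p$. Let $I^{(L)}$ be the $K$-subspace of $I$ consisting of those elements that are $K$-linear combinations of paths of length at most $L$, let $t_1,\dots,t_s$ be a $K$-spanning set of $I^{(L)}$, and let $\tau_{j,p'}(X)$ be the resulting polynomials for $t_j$. Then $V_p$ is the simultaneous vanishing locus of all $\tau_{j,p'}(X)$ in affine space $\mathbb A^N(K)$, $N=\sum_{(\alpha,u)\wr\wr p}|I(\alpha,u)|$ (with coordinates indexed by the variables $X_i(\alpha,u)$); it does not depend on the choice of $t_1,\dots,t_s$. *)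

(* Defs.v *)
From HB Require Import structures.
From mathcomp Require Import all_boot all_order all_algebra boolp.
From mathcomp Require Import freeg mpoly.

Set Implicit Arguments.
Unset Strict Implicit.
Unset Printing Implicit Defensive.

Import GRing.Theory.
Local Open Scope ring_scope.
Local Open Scope quotient_scope.

Section Span.
Variables (R : pzRingType) (V : lmodType R) (S : V -> Prop).

Definition lspan_pred (x : V) : bool :=
  `[< exists (n : nat) (a : 'I_n -> R) (v : 'I_n -> V),
        (forall i, S (v i)) /\ x = \sum_i a i *: v i >].

Lemma lspan_zmod_closed : zmod_closed lspan_pred.
Proof.
split.
  apply/asboolP; exists 0, (fun _ => 0), (fun _ => 0).
  by rewrite big_ord0; split=> [[]|].
move=> _ _ /asboolP[n [a [v [Sv ->]]]] /asboolP[m [b [w [Sw ->]]]].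
apply/asboolP; exists (n + m)%N,
  (fun i => match split i with inl j => a j | inr j => - b j end),
  (fun i => match split i with inl j => v j | inr j => w j end); split.
  by move=> i; case: (split i).
rewrite big_split_ord /=; congr (_ + _); last rewrite -sumrN.
  by apply: eq_bigr => i _; rewrite -[lshift _ _]/(unsplit (inl i)) unsplitK.
apply: eq_bigr => i _; rewrite -[rshift _ _]/(unsplit (inr i)) unsplitK.
by rewrite scaleNr.
Qed.

Lemma lspan_scaler_closed : GRing.scaler_closed lspan_pred.
Proof.
move=> c _ /asboolP[n [a [v [Sv ->]]]]; apply/asboolP.
exists n, (fun i => c * a i), v; split=> //.
by rewrite scaler_sumr; apply: eq_bigr => i _; rewrite scalerA.
Qed.

HB.instance Definition _ :=
  GRing.isZmodClosed.Build V lspan_pred lspan_zmod_closed.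
HB.instance Definition _ :=
  GRing.isScaleClosed.Build R V lspan_pred lspan_scaler_closed.

Definition lspan : submodClosed V := GRing.SubmodClosed.clone R V lspan_pred _.

End Span.

Section SubAndQuotientModules.
Variables (R : pzRingType) (V : lmodType R) (S : submodClosed V).

Definition submod_type : Type := {x : V | x \in S}.
HB.instance Definition _ := SubChoice.on submod_type.
HB.instance Definition _ := [SubChoice_isSubLmodule of submod_type by <:].

(* [{quot _}] wants a [zmodClosed], which [submodClosed] does not provide. *)
Definition submod_mem (x : V) : bool := x \in S.

Lemma submod_zmod_closed : zmod_closed submod_mem.
Proof.
split=> [|x y Sx Sy]; first exact: rpred0.
by rewrite -scaleN1r; apply: rpredD => //; apply: rpredZ.
Qed.
HB.instance Definition _ :=
  GRing.isZmodClosed.Build V submod_mem submod_zmod_closed.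

Definition quotmod : Type :=
  Quotient.quot (GRing.ZmodClosed.clone V submod_mem _).
HB.instance Definition _ := EqQuotient.on quotmod.
HB.instance Definition _ := GRing.Zmodule.on quotmod.
Lemma quotmodP (x y : V) : (x - y \in S) = (x == y %[mod quotmod]).
Proof. by rewrite eqmodE. Qed.

Definition quot_scale (a : R) : quotmod -> quotmod :=
  lift_op1 quotmod ( *:%R a).

Lemma pi_scale a : {morph \pi : x / a *: x >-> quot_scale a x}.
Proof.
move=> x; unlock quot_scale; apply/eqP.
by rewrite -quotmodP -scalerBr rpredZ // quotmodP reprK.
Qed.

Lemma quot_pi_is_additive : {morph \pi_quotmod : x y / x + y}.
Proof. by move=> x y; rewrite piE. Qed.

Lemma quot_scaleA a b x : quot_scale a (quot_scale b x) = quot_scale (a * b) x.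
Proof. by rewrite -[x]reprK -!pi_scale scalerA. Qed.
Lemma quot_scale1 : left_id 1 quot_scale.
Proof. by move=> x; rewrite -[x]reprK -!pi_scale scale1r. Qed.
Lemma quot_scaleDr : right_distributive quot_scale +%R.
Proof.
move=> a x y; rewrite -[x]reprK -[y]reprK.
by rewrite -quot_pi_is_additive -!pi_scale -quot_pi_is_additive scalerDr.
Qed.
Lemma quot_scaleDl x : {morph quot_scale^~ x : a b / a + b}.
Proof.
move=> a b; rewrite -[x]reprK -!pi_scale -quot_pi_is_additive.
by rewrite scalerDl.
Qed.
HB.instance Definition _ := GRing.Zmodule_isLmodule.Build R quotmod
  quot_scaleA quot_scale1 quot_scaleDr quot_scaleDl.

End SubAndQuotientModules.

Section QuotientRing.
Variable R : pzRingType.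

Record ideal := Ideal {
  ideal_pred :> {pred R};
  ideal_zmod : zmod_closed ideal_pred;
  idealMl : forall a x, x \in ideal_pred -> a * x \in ideal_pred;
  idealMr : forall x a, x \in ideal_pred -> x * a \in ideal_pred }.

Variable I : ideal.

Definition ideal_mem (x : R) : bool := x \in I.
Lemma ideal_mem_zmod : zmod_closed ideal_mem. Proof. exact: ideal_zmod. Qed.
HB.instance Definition _ :=
  GRing.isZmodClosed.Build R ideal_mem ideal_mem_zmod.

Definition quotring : Type :=
  Quotient.quot (GRing.ZmodClosed.clone R ideal_mem _).
HB.instance Definition _ := EqQuotient.on quotring.
HB.instance Definition _ := GRing.Zmodule.on quotring.

Lemma quotringP (x y : R) : (x - y \in I) = (x == y %[mod quotring]).
Proof. by rewrite eqmodE. Qed.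

Definition quot_mul : quotring -> quotring -> quotring :=
  lift_op2 quotring *%R.

Lemma pi_mulI : {morph \pi : x y / x * y >-> quot_mul x y}.
Proof.
move=> x y; unlock quot_mul; apply/eqP; rewrite -quotringP.
rewrite -[x * y](subrK (x * repr (\pi_quotring y))) -mulrBr -addrA -mulrBl.
apply: (@rpredD _ (GRing.ZmodClosed.clone R ideal_mem _)).
  by apply: idealMl; rewrite quotringP reprK.
by apply: idealMr; rewrite quotringP reprK.
Qed.

Lemma pi_addI : {morph \pi_quotring : x y / x + y}.
Proof. by move=> x y; rewrite piE. Qed.

Lemma quot_mulA : associative quot_mul.
Proof.
by move=> x y z; rewrite -[x]reprK -[y]reprK -[z]reprK -!pi_mulI mulrA.
Qed.
Lemma quot_mul1l : left_id (\pi_quotring 1) quot_mul.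
Proof. by move=> x; rewrite -[x]reprK -!pi_mulI mul1r. Qed.
Lemma quot_mul1r : right_id (\pi_quotring 1) quot_mul.
Proof. by move=> x; rewrite -[x]reprK -!pi_mulI mulr1. Qed.
Lemma quot_mulDl : left_distributive quot_mul +%R.
Proof.
move=> x y z; rewrite -[x]reprK -[y]reprK -[z]reprK.
by rewrite -pi_addI -!pi_mulI -pi_addI mulrDl.
Qed.
Lemma quot_mulDr : right_distributive quot_mul +%R.
Proof.
move=> x y z; rewrite -[x]reprK -[y]reprK -[z]reprK.
by rewrite -pi_addI -!pi_mulI -pi_addI mulrDr.
Qed.
HB.instance Definition _ := GRing.Zmodule_isPzRing.Build quotring
  quot_mulA quot_mul1l quot_mul1r quot_mulDl quot_mulDr.

End QuotientRing.

(* Nonemptiness of the vertex set makes the path algebra a nonzero ring, as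
   required of the coefficient ring of [mpoly]. *)
Record quiver := Quiver {
  vertex : finType;
  arrow : finType;
  asrc : arrow -> vertex;
  atgt : arrow -> vertex;
  vertex_gt0 : (0 < #|vertex|)%N }.

Section Paths.
Variable Gamma : quiver.
Local Notation V := (vertex Gamma).
Local Notation A := (arrow Gamma).

Fixpoint walk (x : V) (s : seq A) : bool :=
  if s is a :: s' then (asrc a == x) && walk (atgt a) s' else true.

(* A path is its starting vertex together with the list of its arrows in the
   order in which they are traversed: the path usually written
   [a_l ... a_2 a_1] is [(asrc a_1, [:: a_1; a_2; ...; a_l])]. *)
Record qpath := QPath { qdata : V * seq A; _ : walk qdata.1 qdata.2 }.
HB.instance Definition _ := [isSub for qdata].
HB.instance Definition _ := [Countable of qpath by <:].

Definition pstart (p : qpath) : V := (qdata p).1.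
Definition parrows (p : qpath) : seq A := (qdata p).2.
Definition plength (p : qpath) : nat := size (parrows p).
Definition pvertices (p : qpath) : seq V :=
  pstart p :: map (@atgt _) (parrows p).
Definition pend (p : qpath) : V := last (pstart p) (map (@atgt _) (parrows p)).

Definition ptrivial (x : V) : qpath := @QPath (x, [::]) isT.

Lemma parrow_walk (a : A) : walk (asrc a) [:: a].
Proof. by rewrite /= eqxx. Qed.
Definition parrow (a : A) : qpath := @QPath (asrc a, [:: a]) (parrow_walk a).

Lemma walk_cat x s1 s2 :
  walk x (s1 ++ s2) = walk x s1 && walk (last x (map (@atgt _) s1)) s2.
Proof. by elim: s1 x => //= a s IH x; rewrite IH andbA. Qed.

(* The product "[q] after [p]"; [None] when it is not defined. *)
Definition path_comp (q p : qpath) : option qpath :=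
  if pstart q == pend p then insub (pstart p, parrows p ++ parrows q) else None.

Lemma path_compP q p r :
  path_comp q p = Some r <->
  [/\ pstart q = pend p, pstart r = pstart p &
      parrows r = parrows p ++ parrows q].
Proof.
rewrite /path_comp; split=> [|[-> rs ra]].
  case: eqP => // e; case: insubP => // u _ /= E [<-].
  by rewrite /pstart /parrows E.
rewrite eqxx; case: insubP => [u _ E|/negP[]] /=.
  by congr Some; apply: val_inj; rewrite E -rs -ra; case: (r) => [[]].
by rewrite -rs -ra; case: (r).
Qed.

Lemma qpathP p q : pstart p = pstart q -> parrows p = parrows q -> p = q.
Proof.
by case: p q => [[x s] hp] [[y t] hq] /= e1 e2; apply: val_inj; congr pair.
Qed.

Lemma path_comp_def q p : pstart q = pend p -> {r | path_comp q p = Some r}.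
Proof.
move=> e; case E: (path_comp q p) => [r|]; first by exists r.
exfalso; move: E; rewrite /path_comp e eqxx; case: insubP => // /negP[] /=.
rewrite walk_cat -/(pend p) -e.
by case: (p) (q) => [[x s] hp] [[y t] hq]; rewrite /= hp.
Qed.

Lemma path_comp_None q p : pstart q <> pend p -> path_comp q p = None.
Proof. by rewrite /path_comp; case: eqP. Qed.

Lemma pend_path_comp q p r : path_comp q p = Some r -> pend r = pend q.
Proof.
move=> /path_compP[e er ea]; rewrite /pend er ea map_cat last_cat.
by rewrite -/(pend p) -e.
Qed.

Lemma path_comp1p p : path_comp (ptrivial (pend p)) p = Some p.
Proof. by apply/path_compP; rewrite cats0. Qed.

Lemma path_compp1 p : path_comp p (ptrivial (pstart p)) = Some p.
Proof. by apply/path_compP. Qed.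

Lemma path_compA r q p :
  obind (fun x => path_comp x p) (path_comp r q) =
  obind (path_comp r) (path_comp q p).
Proof.
have [e1|n1] := eqVneq (pstart r) (pend q); last first.
  rewrite (path_comp_None (q := r)) /=; last exact/eqP.
  case E: (path_comp q p) => [x|] //=; rewrite path_comp_None //.
  by rewrite (pend_path_comp E); apply/eqP.
have [x Ex] := path_comp_def e1; rewrite Ex /=; have /path_compP[_ xs xa] := Ex.
have [e2|n2] := eqVneq (pstart q) (pend p); last first.
  rewrite [path_comp q p]path_comp_None /=; last exact/eqP.
  by rewrite path_comp_None // xs; apply/eqP.
have [y Ey] := path_comp_def e2; rewrite Ey /=; have /path_compP[_ ys ya] := Ey.
have [z Ez] := path_comp_def (etrans xs e2); rewrite Ez; apply/esym/path_compP.
have /path_compP[_ zs za] := Ez; split; first by rewrite (pend_path_comp Ey).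
  by rewrite zs ys.
by rewrite za xa ya catA.
Qed.

Definition right_subpath (v p : qpath) : bool :=
  (pstart v == pstart p) && prefix (parrows v) (parrows p).

Lemma right_subpathP v p :
  reflect (exists w, path_comp w v = Some p) (right_subpath v p).
Proof.
apply: (iffP andP) => [[/eqP e /prefixP[s es]]|[w]]; last first.
  move=> /path_compP[_ <- ->]; by rewrite eqxx prefix_prefix.
have : walk (pend v) s.
  have := valP p; rewrite -[(val p).2]/(parrows p) es walk_cat => /andP[_].
  by rewrite -[(val p).1]/(pstart p) -e.
move=> hw; exists (@QPath (pend v, s) hw); apply/path_compP; split=> //.
Qed.

Lemma ptake_walk n p : walk (pstart p) (take n (parrows p)).
Proof.
case: p => [[x s] /= h]; rewrite /pstart /parrows /=.
by move: h; rewrite -{1}(cat_take_drop n s) walk_cat => /andP[].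
Qed.
Definition ptake (n : nat) (p : qpath) : qpath :=
  @QPath (pstart p, take n (parrows p)) (ptake_walk n p).

Definition right_subpaths (p : qpath) : seq qpath :=
  [seq ptake n p | n <- iota 0 (plength p).+1].

Lemma mem_right_subpaths v p : (v \in right_subpaths p) = right_subpath v p.
Proof.
apply/mapP/andP => [[n _ ->]|[/eqP e1 e2]].
  by split; rewrite /pstart ?eqxx //= /parrows /= prefixE size_take;
     case: ltnP => // h; rewrite ?take_size ?(take_oversize h).
exists (plength v).
  case/prefixP: e2 => s e2.
  by rewrite mem_iota /= add0n ltnS /plength e2 size_cat leq_addr.
by apply: qpathP => //=; rewrite /parrows /=; move: e2; rewrite prefixE => /eqP.
Qed.

Definition rsub (p : qpath) : finType := seq_sub (right_subpaths p).

Definition is_detour (p : qpath) (a : A) (u : qpath) : bool :=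
  [&& right_subpath u p,
      path_comp (parrow a) u != None,
      (if path_comp (parrow a) u is Some au
       then ~~ right_subpath au p else true) &
      [exists v : rsub p, (plength u + 1 <= plength (val v))%N
                          && (pend (val v) == atgt a)]].

(* The variables [X_i(a, u)]: the index [i] is represented by the path
   [v_i(a, u)] itself, so that a variable is a triple [(a, u, v_i(a, u))]. *)
Definition dvar (p : qpath) : finType :=
  {x : A * rsub p * rsub p |
     [&& is_detour p x.1.1 (val x.1.2),
         (plength (val x.1.2) < plength (val x.2))%N &
         pend (val x.2) == atgt x.1.1]}.

Definition dvar_detour p (x : dvar p) : A * qpath :=
  ((val x).1.1, val (val x).1.2).
Definition dvar_path p (x : dvar p) : qpath := val (val x).2.

Definition is_route (p q : qpath) : bool :=
  (pstart q == pstart p) && subseq (pvertices q) (pvertices p).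

(* Paths of length [0] are included. *)
Definition oriented_cycle (c : qpath) : bool := pstart c == pend c.

End Paths.
Section PathAlgebra.
Variables (K : fieldType) (Gamma : quiver).
Local Notation path := (qpath Gamma).

Definition pathalg : Type := {freeg path / K}.
HB.instance Definition _ := GRing.Lmodule.on pathalg.

Definition pelt (p : path) : pathalg := << p >>.

Definition pmul (q p : path) : pathalg :=
  if path_comp q p is Some r then pelt r else 0.

Definition plift (M : lmodType K) (h : path -> M) : pathalg -> M := fglift h.

Definition pcoeff (p : path) : pathalg -> K := coeff p.
Definition psupp (f : pathalg) : seq path := dom f.

Definition pa_mul (f g : pathalg) : pathalg :=
  plift (fun q => plift (pmul q) g) f.

Definition pa_one : pathalg := \sum_(x : vertex Gamma) pelt (ptrivial x).

Lemma pathalgE (f : pathalg) : f = \sum_(p <- psupp f) pcoeff p f *: pelt p.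
Proof.
rewrite -{1}[f]freeg_sumE; apply: eq_bigr => p _; apply/eqP/freeg_eqP => q.
by rewrite coeffZ !coeffU mul1r.
Qed.

Lemma plift_is_zmod_morphism (M : lmodType K) (h : path -> M) :
  zmod_morphism (plift h).
Proof. exact: lift_is_additive. Qed.
HB.instance Definition _ (M : lmodType K) (h : path -> M) :=
  GRing.isZmodMorphism.Build pathalg M (plift h) (plift_is_zmod_morphism h).

Lemma plift_elt (M : lmodType K) (h : path -> M) p : plift h (pelt p) = h p.
Proof. by rewrite /plift liftU scale1r. Qed.

HB.instance Definition _ p := GRing.isZmodMorphism.Build pathalg K (pcoeff p)
  (coeff_is_additive p).

Lemma pcoeffZ p c f : pcoeff p (c *: f) = c * pcoeff p f.
Proof. exact: coeffZ. Qed.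

Lemma pcoeff_elt p q : pcoeff p (pelt q) = (q == p)%:R.
Proof. by rewrite /pcoeff coeffU mul1r. Qed.

Lemma pathalgP f g : (forall p, pcoeff p f = pcoeff p g) -> f = g.
Proof. by move=> h; apply/eqP/freeg_eqP. Qed.

Lemma plift_scale (M : lmodType K) (h : path -> M) c (f : pathalg) :
  plift h (c *: f) = c *: plift h f.
Proof.
have E (g : pathalg) : plift h g = \sum_(p <- psupp g) pcoeff p g *: h p.
  rewrite {1}[g]pathalgE raddf_sum; apply: eq_bigr => p _ /=.
  suff -> : pcoeff p g *: pelt p = << pcoeff p g *g p >>.
    by rewrite /plift liftU.
  by apply/eqP/freeg_eqP => q; rewrite coeffZ !coeffU mul1r.
rewrite E (E f) scaler_sumr.
have -> : \sum_(p <- psupp (c *: f)) pcoeff p (c *: f) *: h p =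
          \sum_(p <- psupp f) pcoeff p (c *: f) *: h p.
  have [->|c0] := eqVneq c 0.
    rewrite scale0r /psupp dom0 big_nil big1 // => p _.
    by rewrite raddf0 scale0r.
  by apply: perm_big; apply: uniq_perm; rewrite ?uniq_dom //; apply: domZ.
by apply: eq_bigr => p _; rewrite pcoeffZ scalerA.
Qed.

Lemma pa_mulDl : left_distributive pa_mul +%R.
Proof. by move=> f g h; rewrite /pa_mul raddfD. Qed.

Lemma plift_sum (M : lmodType K) (h : path -> M) (f : pathalg) :
  plift h f = \sum_(p <- psupp f) pcoeff p f *: h p.
Proof.
rewrite {1}[f]pathalgE raddf_sum; apply: eq_bigr => p _.
by rewrite /= plift_scale plift_elt.
Qed.

Lemma pa_mulDr : right_distributive pa_mul +%R.
Proof.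
move=> f g h; rewrite /pa_mul !plift_sum -big_split; apply: eq_bigr => p _ /=.
by rewrite -scalerDr raddfD.
Qed.

Lemma pa_mulZl c f g : pa_mul (c *: f) g = c *: pa_mul f g.
Proof. exact: plift_scale. Qed.

Lemma pa_mulZr c f g : pa_mul f (c *: g) = c *: pa_mul f g.
Proof.
rewrite /pa_mul !plift_sum scaler_sumr; apply: eq_bigr => p _.
by rewrite plift_scale !scalerA mulrC.
Qed.

Lemma pa_mulE q p : pa_mul (pelt q) (pelt p) = pmul q p.
Proof. by rewrite /pa_mul !plift_elt. Qed.

Lemma pa_mul0l f : pa_mul 0 f = 0. Proof. by rewrite /pa_mul raddf0. Qed.
Lemma pa_mul0r f : pa_mul f 0 = 0.
Proof. by rewrite -[X in pa_mul _ X](scale0r 0) pa_mulZr scale0r. Qed.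

Lemma pa_mul_suml (I : Type) (r : seq I) (P : pred I) F g :
  pa_mul (\sum_(i <- r | P i) F i) g = \sum_(i <- r | P i) pa_mul (F i) g.
Proof. by rewrite /pa_mul raddf_sum. Qed.
Lemma pa_mul_sumr (I : Type) (r : seq I) (P : pred I) F g :
  pa_mul g (\sum_(i <- r | P i) F i) = \sum_(i <- r | P i) pa_mul g (F i).
Proof.
by elim/big_rec2: _ => [|i x y _ <-]; rewrite ?pa_mul0r ?pa_mulDr.
Qed.

Lemma pathalg_ind (P : pathalg -> Prop) :
  P 0 -> (forall f g, P f -> P g -> P (f + g)) ->
  (forall c p, P (c *: pelt p)) -> forall f, P f.
Proof. by move=> P0 PD Pb f; rewrite [f]pathalgE; elim/big_ind: _. Qed.

Lemma pa_mulA : associative pa_mul.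
Proof.
move=> f g h; elim/pathalg_ind: f => [|f f' ? ?|c r]; last first.
- elim/pathalg_ind: g => [|g g' ? ?|d q]; last first.
  + elim/pathalg_ind: h => [|h h' ? ?|e p]; last first.
    * do !rewrite ?pa_mulZl ?pa_mulZr; rewrite [e *: (d *: _)]scalerA mulrC.
      rewrite -scalerA; do 3!congr (_ *: _).
      rewrite !pa_mulE /pmul.
      have := path_compA r q p.
      case: (path_comp q p) => [y|] /=; case: (path_comp r q) => [x|] /=;
        rewrite ?(pa_mul0l, pa_mul0r, pa_mulE) /pmul //.
      - by move=> ->.
      - by move=> <-.
      - by move=> ->.
    * by rewrite !pa_mulDr; congr (_ + _).
    * by rewrite !pa_mul0r.
  + by rewrite !(pa_mulDr, pa_mulDl); congr (_ + _).
  + by rewrite !(pa_mul0r, pa_mul0l).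
- by rewrite !pa_mulDl; congr (_ + _).
- by rewrite !pa_mul0l.
Qed.

Lemma pa_mul1l : left_id pa_one pa_mul.
Proof.
elim/pathalg_ind => [|f g Hf Hg|c p]; first exact: pa_mul0r.
  by rewrite pa_mulDr Hf Hg.
rewrite pa_mulZr /pa_one pa_mul_suml; congr (_ *: _).
rewrite (bigD1 (pend p)) //= big1 => [|x xp].
  by rewrite pa_mulE /pmul path_comp1p addr0.
by rewrite pa_mulE /pmul path_comp_None //; apply/eqP.
Qed.

Lemma pa_mul1r : right_id pa_one pa_mul.
Proof.
elim/pathalg_ind => [|f g Hf Hg|c p]; first exact: pa_mul0l.
  by rewrite pa_mulDl Hf Hg.
rewrite pa_mulZl /pa_one pa_mul_sumr; congr (_ *: _).
rewrite (bigD1 (pstart p)) //= big1 => [|x xp].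
  by rewrite pa_mulE /pmul path_compp1 addr0.
by rewrite pa_mulE /pmul path_comp_None //= => e; rewrite /pend /= e eqxx in xp.
Qed.

Lemma pa_one_neq0 : pa_one != 0.
Proof.
have /card_gt0P[x _] := vertex_gt0 Gamma.
apply/eqP => /(congr1 (pcoeff (ptrivial x))) /eqP.
rewrite raddf0 raddf_sum (bigD1 x) //= pcoeff_elt eqxx big1 => [|y yx].
  by rewrite addr0 oner_eq0.
by rewrite pcoeff_elt; case: eqP => // -[] /eqP; rewrite (negPf yx).
Qed.

HB.instance Definition _ := GRing.Zmodule_isNzRing.Build pathalg
  pa_mulA pa_mul1l pa_mul1r pa_mulDl pa_mulDr pa_one_neq0.

Lemma pelt_mul q p : pelt q * pelt p = pmul q p.
Proof. exact: pa_mulE. Qed.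

Lemma pathalg_scalerAl (c : K) (f g : pathalg) : c *: (f * g) = c *: f * g.
Proof. exact/esym/pa_mulZl. Qed.
Lemma pathalg_scalerAr (c : K) (f g : pathalg) : c *: (f * g) = f * (c *: g).
Proof. exact/esym/pa_mulZr. Qed.

HB.instance Definition _ :=
  GRing.Lmodule_isLalgebra.Build K pathalg pathalg_scalerAl.
HB.instance Definition _ :=
  GRing.Lalgebra_isAlgebra.Build K pathalg pathalg_scalerAr.

End PathAlgebra.
Arguments pelt K {Gamma} p.
Section ModuleNotions.
Variable R : pzRingType.

Definition uniserial (U : lmodType R) : Prop :=
  forall S T : submodClosed U, {subset S <= T} \/ {subset T <= S}.

Definition covers (U : lmodType R) (S T : submodClosed U) : Prop :=
  [/\ {subset S <= T}, ~ {subset T <= S} &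
      forall W : submodClosed U,
        {subset S <= W} -> {subset W <= T} -> W =i S \/ W =i T].

(* There is a composition series [0 = c 0 < c 1 < ... < c n = U]; only the
   values [c 0, ..., c n] matter. *)
Definition composition_length (U : lmodType R) (n : nat) : Prop :=
  exists c : nat -> submodClosed U,
    [/\ c 0%N =i pred1 0, c n =i predT &
        forall i, (i < n)%N -> covers (c i) (c i.+1)].

Definition lmod_iso (U W : lmodType R) : Prop :=
  exists f : {linear U -> W}, bijective f.

Definition maximal_left_ideal (M : submodClosed R^o) : Prop :=
  ~ M =i predT /\
  forall N : submodClosed R^o, {subset M <= N} -> N =i M \/ N =i predT.

Definition jacobson (x : R) : Prop :=
  forall M : submodClosed R^o, maximal_left_ideal M -> (x : R^o) \in M.

Fixpoint jacobson_pow (n : nat) (x : R) : Prop :=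
  if n is m.+1 then
    (x : R^o) \in lspan (V := R^o)
      (fun z : R => exists a b, [/\ jacobson a, jacobson_pow m b & z = a * b])
  else True.

Definition loewy_length (L : nat) : Prop :=
  (forall x, jacobson_pow L x -> x = 0) /\
  forall m, (forall x, jacobson_pow m x -> x = 0) -> (L <= m)%N.

End ModuleNotions.

Section BoundQuiver.
Variables (K : fieldType) (Gamma : quiver).
Local Notation KG := (pathalg K Gamma).

(* Membership in the [m]-th power of the ideal generated by the arrows. *)
Definition in_arrow_pow (m : nat) (z : KG) : Prop :=
  forall q, q \in psupp z -> (m <= plength q)%N.

Definition admissible (I : ideal KG) : Prop :=
  (forall z, z \in I -> in_arrow_pow 2 z) /\
  exists m : nat, (2 <= m)%N /\ forall z, in_arrow_pow m z -> z \in I.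

(* The subspace [I^(L)]. *)
Definition low_part (I : ideal KG) (L : nat) (z : KG) : Prop :=
  z \in I /\ forall q, q \in psupp z -> (plength q <= L)%N.

Variable I : ideal KG.
Local Notation Lam := (quotring I).

Definition has_mast (p : qpath Gamma) (U : lmodType Lam) : Prop :=
  composition_length U (plength p).+1 /\
  exists x : U, (\pi_(quotring I) (pelt K p) : Lam) *: x <> 0.

(* Isomorphism types are represented by isomorphism classes. *)
Definition uniserial_types (p : qpath Gamma) : Type :=
  {C : lmodType Lam -> Prop |
    exists U : lmodType Lam, [/\ uniserial U, has_mast p U & C = lmod_iso U]}.

End BoundQuiver.

Section Variety.
Variables (K : fieldType) (Gamma : quiver) (p : qpath Gamma).
Local Notation KG := (pathalg K Gamma).
Local Notation A := (arrow Gamma).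

(* [K[X]] and [KGamma[X]]: the variable attached to [x : dvar p] is
   ['X_(enum_rank x)]. *)
Definition polK : comNzRingType := {mpoly K[#|dvar p|]}.
Definition polKG : nzRingType := {mpoly KG[#|dvar p|]}.

Definition pol_times_path (t : polK) (q : qpath Gamma) : polKG :=
  map_mpoly (fun a : K => a *: pelt K q) t.

Definition detour_pol (a : A) (u : qpath Gamma) : polKG :=
  (pelt K (parrow a) * pelt K u)%:MP -
  \sum_(x : dvar p | dvar_detour x == (a, u))
     'X_(enum_rank x) * (pelt K (dvar_path x))%:MP.

Definition left_ideal_Lp : submodClosed polKG^o :=
  lspan (V := polKG^o) (fun z : polKG =>
    (exists q, ~~ is_route p q /\ z = (pelt K q)%:MP) \/
    (exists a u, is_detour p a u /\ z = detour_pol a u)).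

(* [tau] is the family of coefficients [tau_p'] of the element
   [\sum_p' tau_p' p'] congruent to [z]; each [z] has exactly one. *)
Definition normal_form (z : KG) (tau : rsub p -> polK) : Prop :=
  (z%:MP - \sum_(v : rsub p) pol_times_path (tau v) (val v) : polKG^o)
    \in left_ideal_Lp.

Definition point : Type := {ffun dvar p -> K}.

Definition variety (ts : seq KG) (k : point) : Prop :=
  forall t, t \in ts -> forall tau, normal_form t tau ->
  forall v : rsub p, (tau v).@[fun i => k (enum_val i)] = 0.

Definition detour_elt (k : point) (a : A) (u : qpath Gamma) : KG :=
  pelt K (parrow a) * pelt K u -
  \sum_(x : dvar p | dvar_detour x == (a, u)) k x *: pelt K (dvar_path x).

Variable I : ideal KG.
Local Notation Lam := (quotring I).
Local Notation cl := (\pi_(quotring I)).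
Local Notation e1 := (pelt K (ptrivial (pstart p))).

Definition Lame1 : lmodType Lam :=
  submod_type (lspan (V := Lam^o) (fun x : Lam => x = cl e1)).

Definition detour_gen (k : point) (x : Lame1) : Prop :=
  exists a u, is_detour p a u /\ val x = cl (detour_elt k a u).

Definition nonroute_gen (x : Lame1) : Prop :=
  exists q, ~~ is_route p q /\ val x = cl (pelt K q * e1).

Definition detour_submod (k : point) : submodClosed Lame1 :=
  lspan (detour_gen k).

Definition U_submod (k : point) : submodClosed Lame1 :=
  lspan (fun x => detour_gen k x \/ nonroute_gen x).

End Variety.

(* Main.v *)
From HB Require Import structures.
Require Import Defs.
From mathcomp Require Import all_boot all_order all_algebra boolp.
From mathcomp Require Import freeg mpoly.

(** Write [v_ 0], ..., [v_ l] for the right subpaths of [p], where [v_ i] has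
    length [i]. A point [k] makes the vector space with basis [v_ 0], ...,
    [v_ l] into a representation of the quiver: an arrow [a] sends [v_ i] to
    [v_ i.+1] if that path is [a v_ i], to the combination of later right
    subpaths prescribed by [k] if [a] and [v_ i] form a detour, and to [0]
    otherwise. Arrows only lead to basis vectors with a larger index, while the
    arrows of [p] lead from each basis vector to the next one; hence an element
    with leading term [v_ i] generates everything from [v_ i] on, and the
    representation is uniserial. The row vector [coords k z] is the value of
    [z] at [v_ 0].

    The left ideal of a point [k] is generated by the non-routes and by the
    detour relations at [k]. It is the annihilator of [v_ 0]
    ([mem_point_ideal]): a path that does not kill [v_ 0] is a route
    ([coords_route]), and conversely each element of the path algebra is
    congruent to a combination of the [v_ i]. The latter reduction can be done
    with indeterminate coefficients ([has_normal_formC]); this gives the normal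
    forms that define the variety, and their values at [k] are the coordinates
    at [k]. So the variety is the set of all [k] such that [I] is contained in
    the left ideal of [k] ([varietyP]); elements of [I] of degree at most [L]
    suffice because the paths of length [L] lie in [I]. In other words, the
    variety consists of those [k] for which the representation is a module
    over the bound quiver algebra, and this module is then [Lame1 p I] modulo
    [U_submod I k].

    Modules are compared through frames: a frame at [k] is a generator [x] that
    satisfies the relations of [k] and is not killed by [p]. Its annihilator is
    exactly the left ideal of [k] ([frame_annihilator]), so a module with a
    frame at [k] is uniserial with mast [p] ([frame_uniserial],
    [frame_has_mast]), is determined by [k] up to isomorphism ([frame_iso]),
    and forces [k] to lie on the variety. Conversely every uniserial module with
    mast [p] has a frame ([uniserial_frame]). Indeed, if [x] lies over the
    starting vertex and [p x] is nonzero, the submodules generated by the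
    [v_ i x] strictly decrease because the arrows act nilpotently. As the
    composition length is [l + 1], there is nothing between two consecutive
    ones; so each arrow maps [v_ i x] to a combination of later [v_ j x], and
    the coefficients make up a point [k]. This gives the surjectivity of the
    map, the nonemptiness criterion, and the uniqueness of the uniserial factor
    module with mast [p] in the alternate description: there the class of the
    starting vertex is automatically a frame, by [frame_generator] and
    [exists_frame].

    Finally, two frames [x] and [x'] of one module lie over the starting
    vertex. If no [v_ i] with [0 < i < l] ends there, then [x'] is a nonzero
    multiple of [x] up to a multiple of [p x]. Arrows kill [p x], so [x] and
    [x'] satisfy the same detour relations and belong to the same point
    ([frame_point_inj]). *)

Set Implicit Arguments.
Unset Strict Implicit.
Unset Printing Implicit Defensive.

Import GRing.Theory.
Local Open Scope ring_scope.

(** * Spans *)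

Section SpanTheory.
Variables (R : pzRingType) (V : lmodType R).
Implicit Types S : V -> Prop.

Lemma lspan_gen S x : S x -> x \in lspan S.
Proof.
move=> Sx; apply/asboolP; exists 1%N, (fun _ => 1), (fun _ => x).
by rewrite big_ord1 scale1r.
Qed.

Lemma lspan_ind S (P : V -> Prop) :
  P 0 -> (forall x y, P x -> P y -> P (x + y)) ->
  (forall a x, S x -> P (a *: x)) -> forall x, x \in lspan S -> P x.
Proof.
move=> P0 PD PZ _ /asboolP[n [a [v [Sv ->]]]].
by elim/big_ind: _ => // i _; apply: PZ.
Qed.

Lemma lspan_sub S (T : submodClosed V) :
  (forall x, S x -> x \in T) -> {subset lspan S <= T}.
Proof.
move=> ST; apply: lspan_ind => [|x y|a x Sx]; first exact: rpred0.
  exact: rpredD.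
by apply: rpredZ; apply: ST.
Qed.

End SpanTheory.

(** * Paths and vertices *)

Section PathTheory.
Variable Gamma : quiver.
Local Notation path := (qpath Gamma).
Implicit Types (p q r : path) (a : arrow Gamma).

Lemma path_comp_arrowP a q r :
  path_comp (parrow a) q = Some r <->
  [/\ asrc a = pend q, pstart r = pstart q & parrows r = rcons (parrows q) a].
Proof. by rewrite path_compP -cats1. Qed.

Lemma path_comp_arrow_pvertices a q r :
  path_comp (parrow a) q = Some r -> pvertices r = rcons (pvertices q) (atgt a).
Proof.
by move=> /path_comp_arrowP[_ rs ra]; rewrite /pvertices rs ra map_rcons.
Qed.

Lemma path_comp_arrow_plength a q r :
  path_comp (parrow a) q = Some r -> plength r = (plength q).+1.
Proof.
by move=> /path_comp_arrowP[_ _ ra]; rewrite /plength ra size_rcons.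
Qed.

Lemma path_comp_plength q p r :
  path_comp q p = Some r -> plength r = (plength q + plength p)%N.
Proof.
by move=> /path_compP[_ _ ra]; rewrite /plength ra size_cat addnC.
Qed.

(** Paths are built by adding arrows at the far end, the side on which the
    path algebra acts. *)
Lemma qpath_ind (P : path -> Prop) :
  (forall x, P (ptrivial x)) ->
  (forall a q r, path_comp (parrow a) q = Some r -> P q -> P r) ->
  forall q, P q.
Proof.
move=> P0 PS [[x s] ws]; elim/last_ind: s ws => [|s a IH] ws.
  by rewrite (_ : QPath _ = ptrivial x) //; apply: val_inj.
have /andP[wx /eqP ea] : walk x s && (asrc a == last x (map (@atgt _) s)).
  by have := walk_cat x s [:: a]; rewrite cats1 /= andbT => <-.
apply: (PS a (@QPath _ (x, s) wx)); last exact: IH.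
exact/path_comp_arrowP.
Qed.

Section FixedPath.
Variable p : path.
Local Notation l := (plength p).

Definition subpath_end (i : nat) : vertex Gamma := pend (ptake i p).

Lemma pvertices_ptake i : pvertices (ptake i p) = take i.+1 (pvertices p).
Proof. by rewrite /pvertices /= map_take. Qed.

Lemma size_pvertices q : size (pvertices q) = (plength q).+1.
Proof. by rewrite /= size_map. Qed.

Lemma last_pvertices q x : last x (pvertices q) = pend q.
Proof. by []. Qed.

Lemma plength_ptake i : (i <= l)%N -> plength (ptake i p) = i.
Proof. by move=> il; rewrite /plength size_takel. Qed.

Lemma ptake_plength : ptake l p = p.
Proof. by apply: qpathP => //; rewrite /parrows /= take_size. Qed.

Lemma ptake0 : ptake 0 p = ptrivial (pstart p).
Proof. by apply: qpathP => //; rewrite /parrows /= take0. Qed.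

Lemma ptake_right_subpath i : right_subpath (ptake i p) p.
Proof.
by rewrite /right_subpath eqxx; apply/prefixP; exists (drop i (parrows p));
   rewrite cat_take_drop.
Qed.

Lemma right_subpath_ptake v : right_subpath v p -> v = ptake (plength v) p.
Proof.
case/andP=> /eqP sv; rewrite prefixE => /eqP av.
by apply: qpathP; rewrite // -av.
Qed.

Lemma right_subpath_plength v : right_subpath v p -> (plength v <= l)%N.
Proof.
by case/andP=> _ /prefixP[s es]; rewrite /plength es size_cat leq_addr.
Qed.

Lemma ptake_inj i j : (i <= l)%N -> (j <= l)%N ->
  ptake i p = ptake j p -> i = j.
Proof. by move=> il jl /(congr1 (@plength _)); rewrite !plength_ptake. Qed.

Lemma take_pvertices j : (j <= l)%N ->
  take j.+1 (pvertices p) = rcons (take j (pvertices p)) (subpath_end j).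
Proof.
move=> jl; rewrite (take_nth (pstart p)) ?size_pvertices //; congr rcons.
rewrite /subpath_end -(last_pvertices _ (pstart p)) pvertices_ptake.
by rewrite (take_nth (pstart p)) ?size_pvertices // last_rcons.
Qed.

Lemma ptakeS i : (i < l)%N -> exists a,
  onth (parrows p) i = Some a /\
  path_comp (parrow a) (ptake i p) = Some (ptake i.+1 p).
Proof.
case E: (parrows p) => [|b s]; first by rewrite /plength E.
move=> il; exists (nth b (parrows p) i); rewrite -E; split.
  by rewrite onthE (nth_map b).
have ea : parrows (ptake i.+1 p) = rcons (parrows (ptake i p))
   (nth b (parrows p) i).
  by rewrite /parrows /= (take_nth b).
apply/path_comp_arrowP; split=> //.
have := valP (ptake i.+1 p); rewrite -[X in walk _ X]/(parrows _) ea -cats1.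
by rewrite walk_cat /= andbT => /andP[_ /eqP].
Qed.

(** Matrices are indexed by ordinals, normal forms by right subpaths; [sub_at]
    and [rsub_ord] translate between the two. *)
Definition sub_at (i : 'I_l.+1) : rsub p :=
  SeqSub
    (map_f (fun n => ptake n p) (etrans (mem_iota 0 l.+1 i) (ltn_ord i))).

Lemma val_sub_at i : val (sub_at i) = ptake i p. Proof. by []. Qed.

Lemma rsub_right_subpath (v : rsub p) : right_subpath (val v) p.
Proof. by rewrite -mem_right_subpaths; apply: valP. Qed.

Lemma rsub_plength (v : rsub p) : (plength (val v) < l.+1)%N.
Proof. by rewrite ltnS right_subpath_plength // rsub_right_subpath. Qed.

Definition rsub_ord (v : rsub p) : 'I_l.+1 := Ordinal (rsub_plength v).

Lemma sub_atK : cancel sub_at rsub_ord.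
Proof.
by move=> i; apply: val_inj; rewrite /= plength_ptake // -ltnS.
Qed.

Lemma rsub_ordK : cancel rsub_ord sub_at.
Proof.
move=> v; apply: val_inj; rewrite val_sub_at.
by rewrite -(right_subpath_ptake (rsub_right_subpath v)).
Qed.

Lemma sum_rsub (M : nmodType) (F : rsub p -> M) :
  \sum_v F v = \sum_i F (sub_at i).
Proof.
by rewrite (reindex sub_at) //; exists rsub_ord => ? _;
  [apply: sub_atK | apply: rsub_ordK].
Qed.

Lemma subseq_rcons_cat (T : eqType) (s r : seq T) x :
  subseq (rcons s x) (s ++ r) -> x \in r.
Proof. by elim: s => [|y s IH] /=; rewrite ?sub1seq ?eqxx. Qed.

(** A route [a u] on [p] has to reach the endpoint of [a] at a vertex of [p]
    that comes after [u]; hence it is a right subpath or a detour. *)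
Lemma arrow_subpath_nonroute a i r : (i <= l)%N ->
  path_comp (parrow a) (ptake i p) = Some r -> ~~ right_subpath r p ->
  ~~ is_detour p a (ptake i p) -> ~~ is_route p r.
Proof.
move=> il ar nr; apply: contra => /andP[_].
rewrite (path_comp_arrow_pvertices ar) pvertices_ptake.
rewrite -{2}[pvertices p](cat_take_drop i.+1) => /subseq_rcons_cat ta.
rewrite /is_detour ptake_right_subpath ar nr /=.
move: ta; rewrite -index_mem; set n := index _ _; rewrite size_drop.
rewrite size_pvertices subSS => nl.
have jl : (i.+1 + n < l.+1)%N by rewrite addSn ltnS -ltn_subRL.
apply/existsP; exists (sub_at (Ordinal jl)).
rewrite val_sub_at /= !plength_ptake // ?addn1 ?leq_addr //=.
rewrite -(last_pvertices _ (pstart p)) pvertices_ptake.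
rewrite (take_nth (pstart p)) ?size_pvertices // last_rcons -nth_drop.
by rewrite nth_index // -index_mem size_drop size_pvertices subSS.
Qed.

(** This is how routes grow: a vertex sequence that fits into the vertices of
    [v_ i] can be prolonged by the endpoint of any longer right subpath. *)
Lemma subseq_rcons_take (s : seq (vertex Gamma)) i j :
  (i < j <= l)%N -> subseq s (take i.+1 (pvertices p)) ->
  subseq (rcons s (subpath_end j)) (take j.+1 (pvertices p)).
Proof.
move=> /andP[ij jl] ss; rewrite (take_pvertices jl) -!cats1.
apply: cat_subseq; last exact: subseq_refl.
apply: (subseq_trans ss).
by rewrite -(take_takel (pvertices p) ij) take_subseq.
Qed.

Lemma subseq_take_le (s t : seq (vertex Gamma)) n :
  subseq s (take n t) -> subseq s t.
Proof. by move/subseq_trans; apply; apply: take_subseq. Qed.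

Lemma dvarE (x : dvar p) :
  [/\ is_detour p (dvar_detour x).1 (dvar_detour x).2,
      (plength (dvar_detour x).2 < plength (dvar_path x))%N &
      pend (dvar_path x) = atgt (dvar_detour x).1].
Proof. by have /and3P[? ? /eqP ?] := valP x. Qed.

Lemma dvar_inj (x y : dvar p) :
  dvar_detour x = dvar_detour y -> dvar_path x = dvar_path y -> x = y.
Proof.
case: x y => [[[a u] v] hx] [[[b u'] v'] hy] [ea /val_inj eu] /val_inj ev.
by apply: val_inj; move: ea eu ev => /= -> -> ->.
Qed.

Lemma dvarP a (i j : 'I_l.+1) : is_detour p a (ptake i p) -> (i < j)%N ->
  subpath_end j = atgt a ->
  exists x : dvar p, dvar_detour x = (a, ptake i p) /\ dvar_path x = ptake j p.
Proof.
move=> dau ij ej.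
have hx : [&& is_detour p a (val (sub_at i)),
   (plength (val (sub_at i)) < plength (val (sub_at j)))%N &
   pend (val (sub_at j)) == atgt a].
  by rewrite !val_sub_at dau !plength_ptake ?leq_ord // ij; apply/eqP.
by exists (exist _ (a, sub_at i, sub_at j) hx).
Qed.

Lemma detourP a u : is_detour p a u -> [/\ right_subpath u p &
  exists2 r, path_comp (parrow a) u = Some r & ~~ right_subpath r p].
Proof.
case/and4P=> ru; case: (path_comp _ _) => // r _ nr _.
by split=> //; exists r.
Qed.

End FixedPath.
End PathTheory.

(** * The representation attached to a point *)

Section Representation.
Variables (K : fieldType) (Gamma : quiver) (p : qpath Gamma) (k : point K p).
Local Notation l := (plength p).
Local Notation KG := (pathalg K Gamma).
Local Notation v_ i := (pelt K (ptake i p)).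
Implicit Types (a : arrow Gamma) (q r : qpath Gamma) (z w : KG).

(** The two summands never meet: [a v_ i] is a right subpath in the first case,
    and [a], [v_ i] form a detour in the second. *)
Definition arrow_mx a : 'M[K]_l.+1 :=
  \matrix_(i, j)
    (((onth (parrows p) i == Some a) && (j == i.+1 :> nat))%:R +
     \sum_(x : dvar p | (dvar_detour x == (a, ptake i p))
                        && (dvar_path x == ptake j p)) k x).

Definition vertex_mx (s : vertex Gamma) : 'M[K]_l.+1 :=
  \matrix_(i, j) ((i == j) && (subpath_end p i == s))%:R.

Definition path_mx q : 'M[K]_l.+1 :=
  vertex_mx (pstart q) * \prod_(a <- parrows q) arrow_mx a.

Lemma arrow_mx_neq0 a (i j : 'I_l.+1) : arrow_mx a i j != 0 ->
  (i < j)%N /\ subpath_end p j = atgt a.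
Proof.
rewrite mxE; case: andP => [[/eqP ai /eqP ji] _|_].
  have il : (i < l)%N by rewrite -ltnS -ji.
  have [b [bi cb]] := ptakeS il; rewrite ji; split=> //.
  by move: bi; rewrite ai => -[->]; apply: (pend_path_comp cb).
rewrite add0r; have [x /andP[/eqP xd /eqP xp] _|x0] :=
  pickP (fun x : dvar p => (dvar_detour x == (a, ptake i p))
                        && (dvar_path x == ptake j p)); last first.
  by rewrite big_pred0 ?eqxx.
have [_] := dvarE x; rewrite xd xp /= => lt e; split=> //.
by rewrite !plength_ptake ?leq_ord in lt.
Qed.

Lemma arrow_mx_vertex a s :
  arrow_mx a * vertex_mx s = (atgt a == s)%:R *: arrow_mx a.
Proof.
apply/matrixP => i j; rewrite [LHS]mxE [RHS]mxE (bigD1 j) //= big1 => [|m mj].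
  rewrite [vertex_mx s j j]mxE eqxx addr0 mulrC /=.
  have [->|/arrow_mx_neq0[_ ->] //] := eqVneq (arrow_mx a i j) 0.
  by rewrite !mulr0.
by rewrite [vertex_mx s m j]mxE (negPf mj) mulr0.
Qed.

Lemma vertex_mxM s t : vertex_mx s * vertex_mx t = (s == t)%:R *: vertex_mx s.
Proof.
apply/matrixP => i j; rewrite [LHS]mxE [RHS]mxE (bigD1 i) //= big1 => [|m mi].
  rewrite !mxE eqxx addr0 -!natrM !mulnb /=; congr (_%:R); congr nat_of_bool.
  by case: (subpath_end p i =P s) => [->|]; rewrite /= ?andbF // andbC andbT.
by rewrite mxE eq_sym (negPf mi) mul0r.
Qed.

Lemma path_mx_trivial s : path_mx (ptrivial s) = vertex_mx s.
Proof. by rewrite /path_mx big_nil mulr1. Qed.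

Lemma path_mx_arrow a q r : path_comp (parrow a) q = Some r ->
  path_mx r = path_mx q * arrow_mx a.
Proof.
move=> /path_comp_arrowP[_ rs ra].
by rewrite /path_mx rs ra -cats1 big_cat big_seq1 mulrA.
Qed.

Lemma path_mx_vertex q s :
  path_mx q * vertex_mx s = (pend q == s)%:R *: path_mx q.
Proof.
elim/qpath_ind: q => [x|a q r aq _].
  by rewrite path_mx_trivial vertex_mxM.
rewrite (path_mx_arrow aq) -mulrA arrow_mx_vertex -scalerAr.
by rewrite (pend_path_comp aq).
Qed.

Definition repr_mx : KG -> 'M[K]_l.+1 := plift path_mx.
HB.instance Definition _ :=
  GRing.isZmodMorphism.Build KG 'M[K]_l.+1 repr_mx
    (plift_is_zmod_morphism path_mx).

Lemma repr_mxZ c z : repr_mx (c *: z) = c *: repr_mx z.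
Proof. exact: plift_scale. Qed.

Lemma repr_mx_pelt q : repr_mx (pelt K q) = path_mx q.
Proof. exact: plift_elt. Qed.

(** Vectors are rows and matrices act on them from the right, which reverses
    products. *)
Lemma repr_mxM z w : repr_mx (z * w) = repr_mx w * repr_mx z.
Proof.
elim/pathalg_ind: z => [|z z' Hz Hz'|c q].
- by rewrite mul0r !raddf0 mulr0.
- by rewrite mulrDl !raddfD /= mulrDr Hz Hz'.
rewrite -scalerAl !repr_mxZ -scalerAr; congr (_ *: _).
elim/pathalg_ind: w => [|w w' Hw Hw'|d r].
- by rewrite mulr0 !raddf0 mul0r.
- by rewrite mulrDr !raddfD /= mulrDl Hw Hw'.
rewrite -scalerAr !repr_mxZ -scalerAl; congr (_ *: _).
rewrite pelt_mul !repr_mx_pelt [path_mx q]/path_mx mulrA path_mx_vertex.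
rewrite /pmul; have [e|n] := eqVneq (pend r) (pstart q); last first.
  rewrite path_comp_None ?raddf0; last by apply/eqP; rewrite eq_sym.
  by rewrite scale0r mul0r.
have [qr Eqr] := path_comp_def (esym e); rewrite Eqr scale1r repr_mx_pelt.
have /path_compP[_ es ea] := Eqr.
by rewrite /path_mx es ea big_cat mulrA.
Qed.

(** The representation is generated by the path of length [0], the basis
    vector of index [0]; row [0] of the matrix of [z] is the value of [z] at
    this generator. *)
Definition coords z : 'rV[K]_l.+1 := row 0 (repr_mx z).

Lemma coords_is_zmod_morphism : zmod_morphism coords.
Proof. by move=> z w; rewrite /coords !raddfB. Qed.
HB.instance Definition _ :=
  GRing.isZmodMorphism.Build KG 'rV[K]_l.+1 coords coords_is_zmod_morphism.

Lemma coordsZ c z : coords (c *: z) = c *: coords z.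
Proof. by rewrite /coords repr_mxZ linearZ. Qed.

Lemma coordsM w z : coords (w * z) = coords z *m repr_mx w.
Proof. by rewrite /coords repr_mxM row_mul. Qed.

Lemma coords_arrow a q r : path_comp (parrow a) q = Some r ->
  coords (pelt K r) = coords (pelt K q) *m arrow_mx a.
Proof.
by move=> aq; rewrite /coords !repr_mx_pelt (path_mx_arrow aq) row_mul.
Qed.

Lemma coords_trivial s :
  coords (pelt K (ptrivial s)) = (pstart p == s)%:R *: delta_mx 0 0.
Proof.
apply/rowP => j; rewrite /coords repr_mx_pelt path_mx_trivial !mxE.
rewrite /subpath_end ptake0 -[pend _]/(pstart p) eqxx /= [j == _]eq_sym.
by rewrite andbC -natrM mulnb.
Qed.

Lemma row_arrow_mx_next a (i : 'I_l.+1) (il : (i.+1 < l.+1)%N) :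
  path_comp (parrow a) (ptake i p) = Some (ptake i.+1 p) ->
  row i (arrow_mx a) = delta_mx 0 (Ordinal il).
Proof.
move=> ca; apply/rowP => j; rewrite !mxE.
have [b [bi cb]] := ptakeS il.
have <- : b = a.
  move: cb ca => /path_comp_arrowP[_ _ eb] /path_comp_arrowP[_ _].
  by rewrite eb => /rcons_inj[].
rewrite bi eqxx /= big_pred0 ?addr0 // => x; apply/negP => /andP[/eqP xd _].
have [dx _ _] := dvarE x.
move: dx; rewrite xd /= => /detourP[_ [r]].
by rewrite cb => -[<-]; rewrite ptake_right_subpath.
Qed.

Lemma coords_ptake (i : 'I_l.+1) : coords (v_ i) = delta_mx 0 i.
Proof.
case: i; elim=> [|i IH] il.
  rewrite ptake0 coords_trivial eqxx scale1r; congr delta_mx.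
  exact: val_inj.
have [a [_ ca]] := ptakeS (il : (i < l)%N).
rewrite (coords_arrow ca) (IH (ltnW il)) -rowE.
exact: (row_arrow_mx_next (i := Ordinal (ltnW il))).
Qed.

Lemma coords_pend z s : coords (pelt K (ptrivial s) * z) =
  \row_j ((subpath_end p j == s)%:R * coords z 0 j).
Proof.
rewrite coordsM repr_mx_pelt path_mx_trivial; apply/rowP => j.
rewrite !mxE (bigD1 j) //= big1 => [|m mj].
  by rewrite !mxE eqxx addr0 mulrC.
by rewrite [vertex_mx s m j]mxE (negPf mj) mulr0.
Qed.

(** A nonzero coordinate of [q] at [v_ j] forces [q] to run through a
    subsequence of the vertices of [v_ j]: each arrow of [q] leads to strictly
    longer right subpaths with the right endpoint. *)
Lemma coords_route q (j : 'I_l.+1) : coords (pelt K q) 0 j != 0 ->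
  pstart q = pstart p /\ subseq (pvertices q) (take j.+1 (pvertices p)).
Proof.
elim/qpath_ind: q j => [s|a q r aq IH] j.
  rewrite coords_trivial mxE; case: (pstart p =P s) => [<- _|_]; last first.
    by rewrite mul0r eqxx.
  by rewrite /= eqxx sub0seq.
rewrite (coords_arrow aq) mxE => nz.
have [i /andP[qi ai]] : exists i, (coords (pelt K q) 0 i != 0) &&
    (arrow_mx a i j != 0).
  apply/existsP; apply: contraNT nz; rewrite negb_exists => /forallP h.
  rewrite big1 // => i _; have := h i; rewrite negb_and !negbK.
  by case/orP=> /eqP ->; rewrite ?mul0r ?mulr0.
have [sq ss] := IH i qi; have [ij ej] := arrow_mx_neq0 ai.
have /path_comp_arrowP[_ -> _] := aq; split=> //.
rewrite (path_comp_arrow_pvertices aq) -ej; apply: subseq_rcons_take ss.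
by rewrite ij -ltnS /=.
Qed.

Lemma coords_nonroute q : ~~ is_route p q -> coords (pelt K q) = 0.
Proof.
move=> nr; apply/rowP => j; rewrite [RHS]mxE; apply/eqP; apply: contraNT nr.
case/coords_route=> sq ss; rewrite /is_route sq eqxx /=.
exact: subseq_take_le ss.
Qed.

Definition dvar_ord (x : dvar p) : 'I_l.+1 := rsub_ord (val x).2.

Lemma dvar_pathE x : dvar_path x = ptake (dvar_ord x) p.
Proof. by rewrite -val_sub_at rsub_ordK. Qed.

Lemma dvar_path_eq x (j : 'I_l.+1) :
  (dvar_path x == ptake j p) = (dvar_ord x == j).
Proof.
rewrite dvar_pathE; apply/eqP/eqP => [|-> //].
by move=> e; apply: val_inj; apply: ptake_inj e; rewrite -ltnS.
Qed.

Lemma coords_dvar_sum (c : dvar p -> K) (P : pred (dvar p)) j :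
  coords (\sum_(x | P x) c x *: pelt K (dvar_path x)) 0 j =
  \sum_(x | P x && (dvar_path x == ptake j p)) c x.
Proof.
rewrite raddf_sum summxE big_mkcondr; apply: eq_bigr => x _ /=.
rewrite coordsZ dvar_path_eq {1}dvar_pathE coords_ptake !mxE eqxx eq_sym /=.
by case: ifP; rewrite ?mulr1 ?mulr0.
Qed.

Lemma coords_detour_elt a u : is_detour p a u -> coords (detour_elt k a u) = 0.
Proof.
move=> dau; have [ru [r ar nr]] := detourP dau.
rewrite raddfB /= pelt_mul /pmul ar (coords_arrow ar).
have eu := right_subpath_ptake ru.
have ul : (plength u < l.+1)%N by rewrite ltnS right_subpath_plength.
rewrite [in coords (pelt K u)]eu (coords_ptake (Ordinal ul)) -rowE.
apply/eqP; rewrite subr_eq0; apply/eqP/rowP => j.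
rewrite coords_dvar_sum !mxE /= -eu; case: andP => [[/eqP oa _]|_]; last first.
  by rewrite add0r.
have ul' : (plength u < l)%N.
  by rewrite ltnNge; apply/negP => h; rewrite onthE nth_default ?size_map in oa.
have [b [ob cb]] := ptakeS ul'; move: ob cb; rewrite oa -eu => -[<-].
by rewrite ar => -[er]; rewrite er ptake_right_subpath in nr.
Qed.

End Representation.

(** * Normal forms *)

Section NormalForms.
Variables (K : fieldType) (Gamma : quiver) (p : qpath Gamma).
Local Notation l := (plength p).
Local Notation KG := (pathalg K Gamma).
Local Notation PK := (polK K p).
Local Notation PKG := (polKG K p).
Implicit Types (a : arrow Gamma) (q r : qpath Gamma) (z w : KG).
Implicit Types (t : PK) (P Q : PKG) (tau : rsub p -> PK) (k : point K p).

Definition path_ideal (G : qpath Gamma -> Prop) k : submodClosed KG^o :=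
  lspan (V := KG^o) (fun z : KG =>
    (exists q, G q /\ z = pelt K q) \/
    (exists a u, is_detour p a u /\ z = detour_elt k a u)).

Definition pol_path_ideal (G : qpath Gamma -> Prop) : submodClosed PKG^o :=
  lspan (V := PKG^o) (fun P : PKG =>
    (exists q, G q /\ P = (pelt K q)%:MP) \/
    (exists a u, is_detour p a u /\ P = detour_pol K p a u)).

Definition nonroute q : Prop := ~~ is_route p q.

(** The non-routes that are met when a path acts arrow by arrow on the right
    subpaths of [p]. They turn out to generate the same left ideal as all
    non-routes ([mem_first_ideal] and [mem_point_ideal]), and the relations
    that they impose on a given module are easier to verify. *)
Definition first_nonroute q : Prop :=
  (exists2 s, s != pstart p & q = ptrivial s) \/
  (exists a i, [/\ (i <= l)%N, path_comp (parrow a) (ptake i p) = Some q,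
     ~~ right_subpath q p & ~~ is_detour p a (ptake i p)]).

Lemma first_nonroute_nonroute q : first_nonroute q -> nonroute q.
Proof.
move=> [[s ns ->]|[a [i [il aq nq nd]]]].
  by apply: contra ns => /andP[].
exact: arrow_subpath_nonroute aq nq nd.
Qed.

Lemma path_ideal_first k :
  {subset path_ideal first_nonroute k <= path_ideal nonroute k}.
Proof.
apply: (lspan_sub (T := path_ideal nonroute k)) => z [[q [nq ->]]|dz].
  apply: lspan_gen; left; exists q; split=> //.
  exact: first_nonroute_nonroute.
by apply: lspan_gen; right.
Qed.

Lemma pol_path_ideal_first P :
  P \in pol_path_ideal first_nonroute -> P \in left_ideal_Lp K p.
Proof.
apply: (lspan_sub (T := left_ideal_Lp K p)) => z [[q [nq ->]]|dz].
  apply: lspan_gen; left; exists q; split=> //.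
  exact: first_nonroute_nonroute.
by apply: lspan_gen; right.
Qed.

Lemma coords_path_ideal k z : z \in path_ideal nonroute k -> coords k z = 0.
Proof.
rewrite /path_ideal; move: z.
apply: (lspan_ind (V := KG^o) (P := fun z : KG => coords k z = 0))
  => [|x y xh yh|w x].
- by rewrite raddf0.
- by rewrite raddfD /= xh yh addr0.
case=> [[q [nq ->]]|[a [u [dau ->]]]]; rewrite coordsM.
  by rewrite coords_nonroute ?mul0mx.
by rewrite coords_detour_elt ?mul0mx.
Qed.

Definition combination (c : rsub p -> K) : KG :=
  \sum_(v : rsub p) c v *: pelt K (val v).

Lemma coords_combination k c j : coords k (combination c) 0 j = c (sub_at j).
Proof.
rewrite raddf_sum sum_rsub summxE (bigD1 j) //= big1 => [|i ij].
  by rewrite coordsZ coords_ptake !mxE !eqxx mulr1 addr0.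
by rewrite coordsZ coords_ptake !mxE eq_sym (negPf ij) andbF mulr0.
Qed.

(** ** Polynomial normal forms *)

Definition pol_combination tau : PKG :=
  \sum_(v : rsub p) pol_times_path (tau v) (val v).

Definition pol_scalar : PK -> PKG := map_mpoly (in_alg KG).
HB.instance Definition _ := GRing.RMorphism.on pol_scalar.

Lemma pol_scalarE t :
  pol_scalar t = \sum_(m <- msupp t) (t@_m)%:A%:MP * 'X_[m].
Proof. by apply: eq_bigr => m _; rewrite mmap1_id. Qed.

Lemma pol_times_pathE t q : pol_times_path t q = pol_scalar t * (pelt K q)%:MP.
Proof.
rewrite pol_scalarE mulr_suml; apply: eq_bigr => m _.
rewrite mmap1_id -mulrA -commr_mpolyX mulrA -mpolyCM; congr (_%:MP * _).
by rewrite -scalerAl mul1r.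
Qed.

Lemma pol_scalar_comm t z : pol_scalar t * z%:MP = z%:MP * pol_scalar t.
Proof.
rewrite pol_scalarE mulr_suml mulr_sumr; apply: eq_bigr => m _.
rewrite -mulrA -commr_mpolyX !mulrA -!mpolyCM; congr (_%:MP * _).
by rewrite -scalerAl -scalerAr mul1r mulr1.
Qed.

(** Reduction modulo the smaller left ideal is possible as well; this stronger
    form shows in [coords_eq0_first] that both left ideals agree at a point. *)
Definition has_normal_form P : Prop :=
  exists tau, (P - pol_combination tau : PKG^o) \in
    pol_path_ideal first_nonroute.

Lemma pol_combinationD tau tau' :
  pol_combination (fun v => tau v + tau' v) =
  pol_combination tau + pol_combination tau'.
Proof.
rewrite -big_split; apply: eq_bigr => v _ /=.
by rewrite !pol_times_pathE rmorphD mulrDl.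
Qed.

Lemma pol_combinationM t tau :
  pol_combination (fun v => t * tau v) = pol_scalar t * pol_combination tau.
Proof.
rewrite mulr_sumr; apply: eq_bigr => v _ /=.
by rewrite !pol_times_pathE rmorphM mulrA.
Qed.

Lemma pol_combination0 : pol_combination (fun=> 0) = 0.
Proof.
by apply: big1 => v _; rewrite pol_times_pathE rmorph0 mul0r.
Qed.

Lemma normal_form_in_ideal P :
  (P : PKG^o) \in pol_path_ideal first_nonroute -> has_normal_form P.
Proof. by move=> hP; exists (fun=> 0); rewrite pol_combination0 subr0. Qed.

Lemma normal_form_eqmod P Q :
  (P - Q : PKG^o) \in pol_path_ideal first_nonroute ->
  has_normal_form Q -> has_normal_form P.
Proof.
move=> hPQ [tau hQ]; exists tau.
by rewrite -[P](subrK Q) -addrA; apply: rpredD.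
Qed.

Lemma normal_formD P Q :
  has_normal_form P -> has_normal_form Q -> has_normal_form (P + Q).
Proof.
move=> [tau hP] [tau' hQ]; exists (fun v => tau v + tau' v).
by rewrite pol_combinationD opprD addrACA; apply: rpredD.
Qed.

Lemma normal_form_scale t P :
  has_normal_form P -> has_normal_form (pol_scalar t * P).
Proof.
move=> [tau hP]; exists (fun v => t * tau v).
by rewrite pol_combinationM -mulrBr; apply: (rpredZ (pol_scalar t) hP).
Qed.

Lemma normal_form_sum (J : Type) (s : seq J) (D : pred J) (F : J -> PKG) :
  (forall j, D j -> has_normal_form (F j)) ->
  has_normal_form (\sum_(j <- s | D j) F j).
Proof.
move=> hF; elim/big_ind: _ => //; last exact: normal_formD.
by apply: normal_form_in_ideal; apply: rpred0.
Qed.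

Lemma normal_form_subpath (v : rsub p) : has_normal_form (pelt K (val v))%:MP.
Proof.
exists (fun u => (u == v)%:R); rewrite /pol_combination (bigD1 v) //=.
rewrite big1 => [|u uv]; rewrite pol_times_pathE.
  by rewrite eqxx rmorph1 mul1r addr0 subrr; apply: rpred0.
by rewrite (negPf uv) rmorph0 mul0r.
Qed.

Lemma normal_form_arrow_subpath a (v : rsub p) :
  has_normal_form (pelt K (parrow a) * pelt K (val v))%:MP.
Proof.
have rv := rsub_right_subpath v.
have [dav|ndav] := boolP (is_detour p a (val v)).
  apply: (normal_form_eqmod (Q :=
    \sum_(x : dvar p | dvar_detour x == (a, val v))
     'X_(enum_rank x) * (pelt K (dvar_path x))%:MP)).
    by apply: lspan_gen; right; exists a, (val v).
  apply: normal_form_sum => x _.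
  have -> : 'X_(enum_rank x) = pol_scalar 'X_(enum_rank x).
    by rewrite /pol_scalar map_mpolyX.
  exact/normal_form_scale/normal_form_subpath.
rewrite pelt_mul /pmul; case E: path_comp => [r|]; last first.
  by rewrite raddf0; apply: normal_form_in_ideal; apply: rpred0.
have [rr|nr] := boolP (right_subpath r p).
  have rr' : r \in right_subpaths p by rewrite mem_right_subpaths.
  exact: (normal_form_subpath (SeqSub rr')).
apply: normal_form_in_ideal; apply: lspan_gen; left; exists r; split=> //.
have ev := right_subpath_ptake rv.
right; exists a, (plength (val v)); rewrite -ev; split=> //.
exact: right_subpath_plength.
Qed.

(** The arrows of [q] act one after the other on the combination of right
    subpaths obtained so far; the coefficients are central. *)
Lemma normal_form_path q : has_normal_form (pelt K q)%:MP.
Proof.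
elim/qpath_ind: q => [s|a q r aq [tau hq]].
  have [->|ns] := eqVneq s (pstart p).
    by rewrite -ptake0 -(val_sub_at ord0); apply: normal_form_subpath.
  apply: normal_form_in_ideal; apply: lspan_gen; left.
  by exists (ptrivial s); split=> //; left; exists s.
have -> : pelt K r = pelt K (parrow a) * pelt K q by rewrite pelt_mul /pmul aq.
apply: (normal_form_eqmod (Q := (pelt K (parrow a))%:MP * pol_combination tau)).
  rewrite mpolyCM -mulrBr; exact: (rpredZ (pelt K (parrow a))%:MP hq).
rewrite mulr_sumr; apply: normal_form_sum => v _; rewrite pol_times_pathE.
rewrite mulrA -pol_scalar_comm -mulrA -mpolyCM.
exact/normal_form_scale/normal_form_arrow_subpath.
Qed.

Lemma has_normal_formC z : has_normal_form z%:MP.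
Proof.
elim/pathalg_ind: z => [|z w hz hw|c q].
- by rewrite raddf0; apply: normal_form_in_ideal; apply: rpred0.
- by rewrite raddfD; apply: normal_formD.
have -> : (c *: pelt K q)%:MP = pol_scalar c%:MP * (pelt K q)%:MP :> PKG.
  by rewrite /pol_scalar map_mpolyC -mpolyCM /= -scalerAl mul1r.
exact/normal_form_scale/normal_form_path.
Qed.

(** ** Evaluation at a point *)

Section Evaluation.
Variable k : point K p.

Definition eval_scalar (i : 'I_#|dvar p|) : KG := (k (enum_val i))%:A.

Definition eval_pol : PKG -> KG := mmap idfun eval_scalar.
HB.instance Definition _ := GRing.Additive.on eval_pol.

Lemma mmap1_eval_scalar m :
  mmap1 eval_scalar m = (mmap1 (fun i => k (enum_val i)) m)%:A.
Proof.
rewrite -[RHS]/(in_alg KG _) rmorph_prod; apply: eq_bigr => i _.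
by rewrite rmorphXn.
Qed.

Lemma scalarA_comm (c : K) z : GRing.comm z (c%:A : KG).
Proof. by rewrite /GRing.comm -scalerAl -scalerAr mul1r mulr1. Qed.

Lemma eval_polM P Q : eval_pol (P * Q) = eval_pol P * eval_pol Q.
Proof.
have ch i x : GRing.comm x (eval_scalar i) by apply: scalarA_comm.
have cm (P' : PKG) m m' : GRing.comm (idfun P'@_m) (mmap1 eval_scalar m').
  by rewrite mmap1_eval_scalar; apply: scalarA_comm.
by case: (commr_mmap_is_multiplicative ch cm).
Qed.

Lemma eval_polC z : eval_pol z%:MP = z.
Proof. exact: mmapC. Qed.

Lemma eval_pol_scalar t :
  eval_pol (pol_scalar t) = (t.@[fun i => k (enum_val i)])%:A.
Proof.
rewrite pol_scalarE raddf_sum /meval /mmap.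
rewrite -[RHS]/(in_alg KG _) raddf_sum; apply: eq_bigr => m _ /=.
rewrite eval_polM eval_polC /eval_pol mmapX mmap1_eval_scalar.
by rewrite -scalerAl mul1r scalerA.
Qed.

Lemma eval_pol_combination tau : eval_pol (pol_combination tau) =
  combination (fun v => (tau v).@[fun i => k (enum_val i)]).
Proof.
rewrite raddf_sum; apply: eq_bigr => v _ /=.
by rewrite pol_times_pathE eval_polM eval_pol_scalar eval_polC -scalerAl mul1r.
Qed.

Lemma eval_detour_pol a u : eval_pol (detour_pol K p a u) = detour_elt k a u.
Proof.
rewrite raddfB /= eval_polC; congr (_ - _).
rewrite (raddf_sum eval_pol); apply: eq_bigr => x _ /=.
rewrite eval_polM eval_polC /eval_pol mmapX mmap1U /eval_scalar enum_rankK.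
by rewrite -scalerAl mul1r.
Qed.

Lemma eval_pol_path_ideal G P :
  (P : PKG^o) \in pol_path_ideal G -> (eval_pol P : KG^o) \in path_ideal G k.
Proof.
rewrite {1}/pol_path_ideal; move: P.
apply: (lspan_ind (V := PKG^o)
  (P := fun P : PKG => (eval_pol P : KG^o) \in path_ideal G k))
  => [|x y hx hy|w x hx].
- by rewrite raddf0; apply: rpred0.
- by rewrite raddfD; apply: rpredD.
rewrite [w *: x]/(w * x) eval_polM; apply: (rpredZ (eval_pol w)).
apply: lspan_gen; case: hx => [[q [Gq ->]]|[a [u [dau ->]]]].
  by left; exists q; rewrite eval_polC.
by right; exists a, u; rewrite eval_detour_pol.
Qed.

Definition point_ideal := path_ideal nonroute k.

Lemma normal_form_at z : exists c : rsub p -> K,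
  (z - combination c : KG^o) \in path_ideal first_nonroute k.
Proof.
have [tau /eval_pol_path_ideal] := has_normal_formC z.
rewrite raddfB /= eval_pol_combination eval_polC => h.
by eexists; apply: h.
Qed.

(** The coefficients of a normal form at [k] are the coordinates, so an element
    with zero coordinates is congruent to [0]. *)
Lemma coords_eq0_first z :
  coords k z = 0 -> (z : KG^o) \in path_ideal first_nonroute k.
Proof.
move=> z0; have [c hc] := normal_form_at z.
have c0 v : c v = 0.
  have := coords_path_ideal (path_ideal_first hc).
  rewrite raddfB /= z0 sub0r => /eqP; rewrite oppr_eq0 => /eqP cc.
  by rewrite -[v]rsub_ordK -(coords_combination k) cc mxE.
by move: hc; rewrite /combination big1 ?subr0 // => v _; rewrite c0 scale0r.
Qed.

Lemma mem_point_ideal z : ((z : KG^o) \in point_ideal) = (coords k z == 0).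
Proof.
apply/idP/eqP => [|/coords_eq0_first /path_ideal_first //].
exact: coords_path_ideal.
Qed.

Lemma mem_first_ideal z :
  ((z : KG^o) \in path_ideal first_nonroute k) = (coords k z == 0).
Proof.
apply/idP/eqP => [/path_ideal_first|]; last exact: coords_eq0_first.
exact: coords_path_ideal.
Qed.

End Evaluation.
End NormalForms.

(** * The bound quiver algebra *)

Section NilJacobson.
Variable R : pzRingType.

(** If a maximal left ideal [M] missed [x], then [1 - y x] would lie in [M] for
    some [y]; this element is invertible by a geometric series. *)
Lemma nil_jacobson (x : R) :
  (forall y : R, exists n, (y * x) ^+ n = 0) -> jacobson x.
Proof.
move=> nil M [Mprop Mmax].
pose N := lspan (V := R^o) (fun z : R^o => z \in M \/ z = x :> R).
have MN : {subset M <= N} by move=> z Mz; apply: lspan_gen; left.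
have [NM|NT] := Mmax N MN.
  by rewrite -NM; apply: lspan_gen; right.
have N1 : (1 : R^o) \in N by rewrite NT.
have [y My] : exists y : R, ((1 - y * x : R) : R^o) \in M.
  suff [m [y [Mm e1]]] : exists m (y : R), (m : R^o) \in M /\ 1 = m + y * x.
    by exists y; rewrite {1}e1 addrK.
  move: (1 : R^o) N1; rewrite /N; apply: lspan_ind.
  - by exists 0, 0; rewrite mul0r addr0; split=> //; apply: rpred0.
  - move=> _ _ [m [y [Mm ->]]] [m' [y' [Mm' ->]]].
    exists (m + m'), (y + y'); split; first exact: rpredD.
    by rewrite mulrDl addrACA.
  - move=> a z [Mz|->]; last by exists 0, a; rewrite rpred0 add0r.
    by exists (a *: z), 0; rewrite mul0r addr0; split=> //; apply: rpredZ.
have [n yn] := nil y; case: Mprop => z; rewrite inE.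
(* Recover [1] from [1 - y x] by the geometric series. *)
have M1 : (1 : R^o) \in M.
  have -> : (1 : R^o) = (\sum_(i < n) (y * x) ^+ i : R) *: (1 - y * x : R^o).
    rewrite /GRing.scale /= -opprB mulrN; set u := y * x in yn *.
    have cu : GRing.comm (\sum_(i < n) u ^+ i) (u - 1).
      apply/commr_sym/commr_sum => i _; apply: commrX.
      by apply: commr_sym; apply: commrB; [|apply: commr1].
    by rewrite cu -subrX1 yn sub0r opprK.
  exact: rpredZ.
by rewrite -[z]mulr1; apply: (rpredZ (z : R) M1).
Qed.

End NilJacobson.

Section ArrowPowers.
Variables (K : fieldType) (Gamma : quiver).
Local Notation KG := (pathalg K Gamma).
Implicit Types (q r : qpath Gamma) (z w : KG).

Lemma in_arrow_powP m z :
  in_arrow_pow m z <-> forall q, (plength q < m)%N -> pcoeff q z = 0.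
Proof.
split=> [h q qm|h q]; last first.
  by rewrite mem_dom leqNgt => nz; apply/negP => /h /eqP; rewrite (negPf nz).
apply/eqP; apply: contraLR qm; rewrite -leqNgt => nz.
by apply: h; rewrite mem_dom.
Qed.

Lemma in_arrow_pow0 m : in_arrow_pow m (0 : KG).
Proof. by apply/in_arrow_powP => q _; rewrite raddf0. Qed.

Lemma in_arrow_powD m z w :
  in_arrow_pow m z -> in_arrow_pow m w -> in_arrow_pow m (z + w).
Proof.
move=> /in_arrow_powP hz /in_arrow_powP hw; apply/in_arrow_powP => q qm.
by rewrite raddfD /= hz ?hw ?addr0.
Qed.

Lemma in_arrow_powZ m c z : in_arrow_pow m z -> in_arrow_pow m (c *: z).
Proof.
move=> /in_arrow_powP hz; apply/in_arrow_powP => q qm.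
by rewrite pcoeffZ hz ?mulr0.
Qed.

Lemma in_arrow_pow_pelt m q : (m <= plength q)%N -> in_arrow_pow m (pelt K q).
Proof.
move=> mq; apply/in_arrow_powP => r rm; rewrite pcoeff_elt.
by case: eqP => // e; rewrite e leqNgt rm in mq.
Qed.

Lemma in_arrow_pow_sum m (J : Type) (s : seq J) (D : pred J) (F : J -> KG) :
  (forall j, D j -> in_arrow_pow m (F j)) ->
  in_arrow_pow m (\sum_(j <- s | D j) F j).
Proof.
move=> hF; elim/big_ind: _ => //; first exact: in_arrow_pow0.
by move=> z w; apply: in_arrow_powD.
Qed.

Lemma in_arrow_pow_ind m (P : KG -> Prop) :
  P 0 -> (forall z w, P z -> P w -> P (z + w)) ->
  (forall c q, (m <= plength q)%N -> P (c *: pelt K q)) ->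
  forall z, in_arrow_pow m z -> P z.
Proof.
move=> P0 PD PZ z hz; rewrite [z]pathalgE big_seq.
by elim/big_ind: _ => // q qz; apply: PZ; apply: hz.
Qed.

Lemma in_arrow_powM m n z w :
  in_arrow_pow m z -> in_arrow_pow n w -> in_arrow_pow (m + n) (z * w).
Proof.
move=> hz hw; move: z hz; apply: in_arrow_pow_ind => [|z z' hz hz'|c q mq].
- by rewrite mul0r; apply: in_arrow_pow0.
- by rewrite mulrDl; apply: in_arrow_powD.
move: w hw; apply: in_arrow_pow_ind => [|w w' hw hw'|d r nr].
- by rewrite mulr0; apply: in_arrow_pow0.
- by rewrite mulrDr; apply: in_arrow_powD.
rewrite -scalerAl -scalerAr; do 2!apply: in_arrow_powZ.
rewrite pelt_mul /pmul; case E: path_comp => [s|]; last exact: in_arrow_pow0.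
by apply: in_arrow_pow_pelt; rewrite (path_comp_plength E) leq_add.
Qed.

Lemma in_arrow_powX z n : in_arrow_pow 1 z -> in_arrow_pow n (z ^+ n).
Proof.
move=> hz; elim: n => [|n IH]; first by move=> q _.
by rewrite exprS -add1n; apply: in_arrow_powM.
Qed.

End ArrowPowers.

Section QuotientAlgebra.
Variables (K : fieldType) (Gamma : quiver) (I : ideal (pathalg K Gamma)).
Local Notation KG := (pathalg K Gamma).
Local Notation Lam := (quotring I).
Implicit Types (q r : qpath Gamma) (z w : KG).

Definition cls z : Lam := \pi_(quotring I)%qT z.

Lemma clsD z w : cls (z + w) = cls z + cls w.
Proof. exact: pi_addI. Qed.

Lemma cls_zmod_morphism : zmod_morphism cls.
Proof. by move=> z w; apply: (addIr (cls w)); rewrite -clsD !subrK. Qed.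
HB.instance Definition _ :=
  GRing.isZmodMorphism.Build KG Lam cls cls_zmod_morphism.

Lemma clsM z w : cls (z * w) = cls z * cls w.
Proof. by rewrite /cls pi_mulI. Qed.

Lemma cls1 : cls 1 = 1. Proof. by []. Qed.

Lemma cls_eq0 z : (cls z == 0) = (z \in I).
Proof.
by rewrite -[z in RHS]subr0 quotringP -[\pi_(quotring I)%qT 0]/(cls 0) raddf0.
Qed.

Lemma cls_surj (a : Lam) : exists z, a = cls z.
Proof. by exists (repr a); rewrite /cls reprK. Qed.

Lemma clsX z n : cls (z ^+ n) = cls z ^+ n.
Proof. by elim: n => [|n IH]; rewrite ?expr0 ?cls1 // !exprS clsM IH. Qed.

Hypothesis I_adm : admissible I.

Lemma arrow_jacobson z : in_arrow_pow 1 z -> jacobson (cls z).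
Proof.
move=> hz; apply: nil_jacobson => y; have [w ->] := cls_surj y.
have [_ [m [_ hm]]] := I_adm; exists m; rewrite -clsM -clsX; apply/eqP.
rewrite cls_eq0; apply/hm/in_arrow_powX; rewrite -[1%N]/(0 + 1)%N.
by apply: in_arrow_powM => // q.
Qed.

Lemma jacobson_pow_path q : jacobson_pow (plength q) (cls (pelt K q)).
Proof.
elim/qpath_ind: q => [//|a q r aq IH].
rewrite (path_comp_arrow_plength aq); apply: lspan_gen.
exists (cls (pelt K (parrow a))), (cls (pelt K q)); split=> //.
  by apply/arrow_jacobson/in_arrow_pow_pelt.
by rewrite -clsM pelt_mul /pmul aq.
Qed.

Variables (L : nat) (L_loewy : loewy_length Lam L).

Lemma loewy_length_path q : plength q = L -> pelt K q \in I.
Proof.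
move=> qL; rewrite -cls_eq0; apply/eqP; have [+ _] := L_loewy; apply.
by rewrite -qL; apply: jacobson_pow_path.
Qed.

Lemma long_path_factor q n : (n <= plength q)%N ->
  exists w, pelt K q = w * pelt K (ptake n q).
Proof.
move=> nq; have /right_subpathP[w cw] := ptake_right_subpath q n.
by exists (pelt K w); rewrite pelt_mul /pmul cw.
Qed.

Lemma loewy_long_path q : (L <= plength q)%N -> pelt K q \in I.
Proof.
move=> Lq; have [w ->] := long_path_factor Lq.
by apply: idealMl; apply: loewy_length_path; rewrite plength_ptake.
Qed.

Variables (p : qpath Gamma) (ts : seq KG).
Hypothesis ts_spans : forall z,
  z \in lspan (R := K) (fun t => t \in ts) <-> low_part I L z.

Lemma ideal_add z w : z \in I -> w \in I -> z + w \in I.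
Proof. by rewrite -!cls_eq0 raddfD /= => /eqP -> /eqP ->; rewrite addr0. Qed.

Lemma ideal_scale c z : z \in I -> c *: z \in I.
Proof. by move=> zI; rewrite -[z]mul1r scalerAl; apply: idealMl. Qed.

(** An element of [I] is the sum of its part in degrees at most [L] and of
    left multiples of paths of length exactly [L]. The latter paths belong to
    [I] because the [L]-th power of the radical vanishes, hence so does the
    part in low degrees. *)
Lemma ideal_low_part (k : point K p) :
  (forall z, low_part I L z -> coords k z = 0) ->
  forall z, z \in I -> coords k z = 0.
Proof.
move=> low z zI.
pose s := \sum_(q <- psupp z | (plength q <= L)%N) pcoeff q z *: pelt K q.
pose b := \sum_(q <- psupp z | ~~ (plength q <= L)%N) pcoeff q z *: pelt K q.
have zsb : z = s + b.
  by rewrite {1}[z]pathalgE (bigID (fun q => plength q <= L)%N).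
have bP : b \in I /\ coords k b = 0.
  rewrite /b; elim/big_ind: _ => [|x y [xI x0] [yI y0]|q].
  - by rewrite raddf0 -cls_eq0 raddf0.
  - by rewrite raddfD /= x0 y0 addr0 ideal_add.
  rewrite -ltnNge => Lq; split.
    by apply/ideal_scale/loewy_long_path/ltnW.
  have [w ->] := long_path_factor (ltnW Lq).
  rewrite coordsZ coordsM low ?mul0mx ?scaler0 //; split.
    by apply: loewy_length_path; rewrite plength_ptake // ltnW.
  move=> r; rewrite /psupp domU1 inE => /eqP ->.
  by rewrite plength_ptake // ltnW.
have [bI b0] := bP; rewrite zsb raddfD /= b0 addr0; apply: low; split.
  rewrite -cls_eq0; have := zI; rewrite -cls_eq0 {1}zsb raddfD /=.
  by move: bI; rewrite -cls_eq0 => /eqP ->; rewrite addr0.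
move=> q; rewrite mem_dom -/(pcoeff q s); apply: contraNT => Lq.
rewrite raddf_sum big1 // => r rL /=; rewrite pcoeffZ pcoeff_elt.
by case: eqP => [e|]; rewrite ?mulr0 //; rewrite -e rL in Lq.
Qed.

(** Normal forms specialize to coordinates, so the equations of the variety say
    that the given spanning set has zero coordinates at [k]; the paths of
    length [L] take care of the rest of [I]. *)
Lemma varietyP (k : point K p) :
  variety ts k <-> forall z, z \in I -> coords k z = 0.
Proof.
split=> [var|Ik t ts_t tau nf v].
  apply: ideal_low_part => z /ts_spans; move: z.
  apply: lspan_ind => [|x y x0 y0|c t tst]; first by rewrite raddf0.
    by rewrite raddfD /= x0 y0 addr0.
  rewrite coordsZ; have [tau nf] := has_normal_formC p t.
  have /eval_pol_path_ideal := nf => /(_ k).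
  rewrite raddfB /= eval_polC eval_pol_combination /combination.
  rewrite big1 => [|v _].
    by rewrite subr0 mem_first_ideal => /eqP ->; rewrite scaler0.
  by rewrite (var t tst tau) ?scale0r //; apply: pol_path_ideal_first.
have tI : t \in I by have [] : low_part I L t by apply/ts_spans/lspan_gen.
have /eval_pol_path_ideal : (t%:MP - pol_combination tau : (polKG K p)^o)
  \in @pol_path_ideal K Gamma p (nonroute p) by [].
move=> /(_ k) /coords_path_ideal; rewrite !raddfB /= eval_polC (Ik t tI) sub0r.
rewrite eval_pol_combination => /eqP; rewrite oppr_eq0 => /eqP c0.
have := coords_combination k (fun v => (tau v).@[fun i => k (enum_val i)])
  (rsub_ord v).
by rewrite rsub_ordK c0 mxE.
Qed.

End QuotientAlgebra.

(** * Left ideals containing the ideal of a point *)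

Section PointLeftIdeals.
Variables (K : fieldType) (Gamma : quiver) (p : qpath Gamma) (k : point K p).
Local Notation l := (plength p).
Local Notation KG := (pathalg K Gamma).
Local Notation v_ i := (pelt K (ptake i p)).
Implicit Types (a : arrow Gamma) (q r : qpath Gamma) (z w : KG).

Definition vanish_below (n : nat) z : Prop :=
  forall j : 'I_l.+1, (j < n)%N -> coords k z 0 j = 0.

Lemma path_mx_shift q (i j : 'I_l.+1) :
  (j < i + plength q)%N -> path_mx k q i j = 0.
Proof.
elim/qpath_ind: q i j => [s|a q r aq IH] i j.
  rewrite addn0 path_mx_trivial mxE => ji; case: eqP => // e.
  by rewrite e ltnn in ji.
rewrite (path_mx_arrow _ aq) (path_comp_arrow_plength aq) addnS => ji.
rewrite mxE big1 // => n _.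
have [ni|ni] := ltnP n (i + plength q); first by rewrite IH // mul0r.
have [->|/arrow_mx_neq0[nj _]] := eqVneq (arrow_mx k a n j) 0.
  by rewrite mulr0.
by have := leq_trans (leq_trans nj ji) ni; rewrite ltnn.
Qed.

Lemma repr_mx_strict z (i j : 'I_l.+1) :
  in_arrow_pow 1 z -> (j <= i)%N -> repr_mx k z i j = 0.
Proof.
move=> hz ji; move: z hz; apply: in_arrow_pow_ind => [|z w hz hw|c q q1].
- by rewrite raddf0 mxE.
- by rewrite raddfD mxE [X in X + _]hz [X in _ + X]hw addr0.
rewrite repr_mxZ repr_mx_pelt mxE path_mx_shift ?mulr0 //.
by apply: leq_ltn_trans ji _; rewrite -{1}[i : nat]addn0 ltn_add2l.
Qed.

Lemma vanish_belowD n z w :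
  vanish_below n z -> vanish_below n w -> vanish_below n (z + w).
Proof. by move=> hz hw j jn; rewrite raddfD /= mxE hz ?hw ?addr0. Qed.

Lemma vanish_belowM n z w : vanish_below n z -> vanish_below n (w * z).
Proof.
move=> hz; elim/pathalg_ind: w => [|w w' hw hw'|c q].
- by move=> j _; rewrite mul0r raddf0 mxE.
- by rewrite mulrDl; apply: vanish_belowD.
move=> j jn; rewrite -scalerAl coordsZ coordsM repr_mx_pelt mxE.
rewrite [X in _ * X]mxE big1 ?mulr0 //.
move=> m _; have [mn|nm] := ltnP m n; first by rewrite (hz m mn) mul0r.
by rewrite path_mx_shift ?mulr0 // ltn_addr // (leq_trans jn).
Qed.

Lemma vanish_below_eq0 n z : (l < n)%N -> vanish_below n z -> coords k z = 0.
Proof.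
move=> ln hz; apply/rowP => j; rewrite [RHS]mxE hz //.
exact: leq_ltn_trans (leq_ord j) ln.
Qed.

Lemma leading_coord z : coords k z != 0 ->
  exists2 i : 'I_l.+1, vanish_below i z & coords k z 0 i != 0.
Proof.
move=> nz; have [i hi] : exists i, coords k z 0 i != 0.
  apply/existsP; apply: contraNT nz; rewrite negb_exists => /forallP h.
  by apply/eqP/rowP => j; rewrite [RHS]mxE; apply/eqP/negbNE/h.
case: (arg_minnP (fun i : 'I_l.+1 => i : nat)
  (P := fun i => coords k z 0 i != 0) hi).
move=> m hm min; exists m => // j jm; apply/eqP; apply: contraLR jm => hj.
by rewrite -leqNgt min.
Qed.

Lemma vanish_below_clear (i : 'I_l.+1) z w :
  vanish_below i z -> coords k z 0 i != 0 -> vanish_below i w ->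
  vanish_below i.+1 (w - (coords k w 0 i / coords k z 0 i) *: z).
Proof.
move=> zi nz wi j; rewrite ltnS leq_eqVlt raddfB /= coordsZ.
rewrite mxE [X in _ + X]mxE [X in - X]mxE => /orP[/eqP/val_inj ->|ji].
  by rewrite divfK ?subrr.
by rewrite (wi j ji) (zi j ji) mulr0 subrr.
Qed.

Lemma vanish_below_next a (i : 'I_l.+1) (il : (i.+1 < l.+1)%N) z :
  path_comp (parrow a) (ptake i p) = Some (ptake i.+1 p) -> vanish_below i z ->
  vanish_below i.+1 (pelt K (parrow a) * z) /\
  coords k (pelt K (parrow a) * z) 0 (Ordinal il) = coords k z 0 i.
Proof.
move=> ca zi.
have ri : row i (path_mx k (parrow a)) = delta_mx 0 (Ordinal il).
  have vi : row i (vertex_mx K p (asrc a)) = delta_mx 0 i.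
    apply/rowP => j; rewrite !mxE; have /path_comp_arrowP[-> _ _] := ca.
    by rewrite /subpath_end !eqxx andbT eq_sym.
  rewrite /path_mx big_seq1 row_mul vi -rowE.
  exact: (row_arrow_mx_next k il ca).
have azE (j : 'I_l.+1) : (j <= i.+1)%N -> coords k (pelt K (parrow a) * z) 0 j =
    coords k z 0 i * (j == i.+1 :> nat)%:R.
  move=> ji; rewrite coordsM repr_mx_pelt mxE (bigD1 i) //= big1 => [|m mi].
    have /rowP/(_ j) := ri; rewrite !mxE /= addr0 => ->.
    by congr (_ * (_ : bool)%:R).
  have [im|mi'] := ltnP i m; last by rewrite zi ?mul0r // ltn_neqAle mi.
  by rewrite path_mx_shift ?mulr0 // addn1 ltnS (leq_trans ji).
split=> [j ji|]; last by rewrite azE //= eqxx mulr1.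
by rewrite azE ?(ltnW ji) // ltn_eqF ?mulr0.
Qed.

Definition left_ideal_above (T : KG -> Prop) : Prop :=
  [/\ forall z w, T z -> T w -> T (z + w), forall z w, T z -> T (w * z) &
      forall z, coords k z = 0 -> T z].

(** An element with leading coordinate at [v_ i] produces, under the arrows of
    [p] following [v_ i], elements with leading coordinate at each later right
    subpath; subtracting multiples of these clears all coordinates. *)
Lemma left_ideal_above_leading T : left_ideal_above T ->
  forall (i : 'I_l.+1) z, T z -> vanish_below i z -> coords k z 0 i != 0 ->
  forall w, vanish_below i w -> T w.
Proof.
move=> [TD TM T0] i; move m: (l - i)%N => n.
elim: n i m => [|n IH] i li z Tz zi nz.
all: suff h w : vanish_below i.+1 w -> T w
  by move=> w wi; rewrite -[w](subrK ((coords k w 0 i / coords k z 0 i)%:A * z));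
     apply: TD; [apply: h; rewrite -scalerAl mul1r;
       exact: vanish_below_clear|exact: TM].
  by move=> wi; apply: T0; apply: vanish_below_eq0 wi; rewrite ltnS -subn_eq0 li.
have il : (i < l)%N by rewrite -subn_gt0 li.
have [a [_ ca]] := ptakeS il.
pose i1 : 'I_l.+1 := Ordinal (il : (i.+1 < l.+1)%N).
have [az azi] : vanish_below i1 _ /\ coords k _ 0 i1 = _ :=
  vanish_below_next _ ca zi.
by apply: (IH i1 _ _ (TM _ _ Tz) az); rewrite ?azi //= subnS li.
Qed.

(** Both left ideals are determined by the least index of a leading term that
    occurs in them. *)
Lemma left_ideal_above_total T T' :
  left_ideal_above T -> left_ideal_above T' ->
  (forall z, T z -> T' z) \/ (forall z, T' z -> T z).
Proof.
move=> hT hT'; have [?|] := pselect (forall z, T z -> T' z); first by left.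
move=> /existsNP[z /not_implyP[Tz nT'z]]; right => w T'w.
have nz : coords k z != 0.
  by apply/eqP => z0; apply: nT'z; have [_ _] := hT'; apply.
have [i zi nzi] := leading_coord nz.
have [w0|nw] := eqVneq (coords k w) 0; first by have [_ _] := hT; apply.
have [j wj nwj] := leading_coord nw.
have [ij|ji] := leqP i j; last first.
  case: nT'z; apply: (left_ideal_above_leading hT' T'w wj nwj) => m mj.
  by apply: zi; apply: ltn_trans ji.
apply: (left_ideal_above_leading hT Tz zi nzi) => m mi.
by apply: wj; apply: leq_trans ij.
Qed.

Lemma coords_whole_path : coords k (pelt K p) = delta_mx 0 ord_max.
Proof. by rewrite -(coords_ptake k ord_max) ptake_plength. Qed.

Lemma left_ideal_above_proper T : left_ideal_above T -> ~ T (pelt K p) ->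
  forall z, T z -> coords k z = 0.
Proof.
move=> hT nTp z Tz; apply/eqP; apply/negPn/negP => /leading_coord[i zi nzi].
apply: nTp; apply: (left_ideal_above_leading hT Tz zi nzi) => j ji.
rewrite coords_whole_path mxE /= (_ : (j == ord_max) = false) //.
by apply/eqP => e; rewrite e /= ltnNge leq_ord in ji.
Qed.

End PointLeftIdeals.

(** * Modules of the type of a point *)

Section Frames.
Variables (K : fieldType) (Gamma : quiver) (I : ideal (pathalg K Gamma)).
Local Notation KG := (pathalg K Gamma).
Local Notation Lam := (quotring I).
Variable p : qpath Gamma.
Local Notation l := (plength p).
Local Notation v_ i := (pelt K (ptake i p)).
Implicit Types (U W : lmodType Lam) (z w : KG) (k : point K p).

Definition act U z (x : U) : U := cls I z *: x.

Lemma actDl U z w (x : U) : act (z + w) x = act z x + act w x.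
Proof. by rewrite /act raddfD scalerDl. Qed.
Lemma actM U z w (x : U) : act (z * w) x = act z (act w x).
Proof. by rewrite /act clsM scalerA. Qed.
Lemma act1 U (x : U) : act 1 x = x.
Proof. by rewrite /act cls1 scale1r. Qed.
Lemma act0 U (x : U) : act 0 x = 0.
Proof. by rewrite /act raddf0 scale0r. Qed.
Lemma act_zmod_morphism U z : zmod_morphism (@act U z).
Proof. by move=> x y; rewrite /act scalerBr. Qed.
HB.instance Definition _ U z :=
  GRing.isZmodMorphism.Build U U (@act U z) (act_zmod_morphism z).
Lemma actBl U z w (x : U) : act (z - w) x = act z x - act w x.
Proof. by rewrite /act raddfB scalerBl. Qed.
Lemma act_ideal U z (x : U) : z \in I -> act z x = 0.
Proof. by rewrite -cls_eq0 => /eqP zI; rewrite /act zI scale0r. Qed.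
Lemma act_mem U (S : submodClosed U) z x : x \in S -> act z x \in S.
Proof. exact: rpredZ. Qed.
Lemma act_linear U W (f : {linear U -> W}) z x : f (act z x) = act z (f x).
Proof. exact: linearZ. Qed.

(** The middle condition says that [x] satisfies the relations of [k], by
    [mem_point_ideal]. With the last one it makes the module a copy of the
    representation attached to [k], and [x] the image of the generator. *)
Definition frame U k (x : U) : Prop :=
  [/\ forall y, exists z, y = act z x, forall z, coords k z = 0 -> act z x = 0 &
      act (pelt K p) x <> 0].

Section OneFrame.
Variables (U : lmodType Lam) (k : point K p) (x : U).
Hypothesis xk : frame k x.

Lemma submod_left_ideal_above (S : submodClosed U) :
  left_ideal_above k (fun z => act z x \in S).
Proof.
have [_ xL _] := xk; split=> [z w hz hw|z w hz|z z0].
- by rewrite actDl; apply: rpredD.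
- by rewrite actM; apply: act_mem.
- by rewrite xL //; apply: rpred0.
Qed.

(** A left ideal that contains the ideal of the point strictly also contains
    [p], the socle of the representation. *)
Lemma frame_annihilator z : act z x = 0 <-> coords k z = 0.
Proof.
have [_ xL px] := xk; split=> [zx|]; last exact: xL.
apply: (@left_ideal_above_proper _ _ _ _ (fun z => act z x = 0)) zx => //.
split=> [w w' hw hw'|w w' hw|] //; first by rewrite actDl hw hw' addr0.
by rewrite actM hw raddf0.
Qed.

Lemma frame_uniserial : uniserial U.
Proof.
move=> S T; have [gen _ _] := xk.
have [h|h] := left_ideal_above_total (submod_left_ideal_above S)
  (submod_left_ideal_above T); [left|right] => y.
all: by have [z ->] := gen y; exact: h.
Qed.

(** The layer of index [n] is the submodule of length [n]. *)
Definition frame_layer (n : nat) : submodClosed U :=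
  lspan (fun y => exists2 z, y = act z x & vanish_below k (l.+1 - n) z).

Lemma mem_frame_layer n z :
  act z x \in frame_layer n <-> vanish_below k (l.+1 - n) z.
Proof.
split=> [|zn]; last by apply: lspan_gen; exists z.
suff h y : y \in frame_layer n ->
    exists2 z, y = act z x & vanish_below k (l.+1 - n) z.
  move=> /h[w /eqP]; rewrite -subr_eq0 -actBl => /eqP /frame_annihilator.
  rewrite raddfB => /eqP /=; rewrite subr_eq0 => /eqP e wn j jn.
  by rewrite e wn.
move: y; apply: lspan_ind => [|_ _ [w -> wn] [w' -> wn']|a _ [w -> wn]].
- by exists 0; rewrite ?act0 // => j _; rewrite raddf0 mxE.
- by exists (w + w'); rewrite ?actDl //; apply: vanish_belowD.
- have [b ->] := cls_surj a; exists (b * w); first by rewrite actM.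
  exact: vanish_belowM.
Qed.

Lemma frame_has_mast : has_mast p U.
Proof.
have [gen xL px] := xk; split; last by exists x.
exists frame_layer; split=> [y|y|i il].
- have [z ->] := gen y; rewrite !inE; apply/idP/eqP => [/mem_frame_layer|z0].
    by rewrite subn0 => /vanish_below_eq0 z0; apply: xL; apply: z0.
  by rewrite z0 rpred0.
- have [z ->] := gen y; rewrite inE; apply/mem_frame_layer.
  by rewrite subnn => j.
have ml : (l - i < l.+1)%N by rewrite ltnS leq_subr.
have eS : (l.+1 - i = (l - i).+1)%N by rewrite subSn.
split.
- move=> y; have [z ->] := gen y => /mem_frame_layer zi; apply/mem_frame_layer.
  by move=> j ji; apply: zi; rewrite eS; apply: (leq_trans ji); rewrite subSS.
- move=> /(_ (act (v_ (l - i)) x)) h.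
  have /h/mem_frame_layer : act (v_ (l - i)) x \in frame_layer i.+1.
    apply/mem_frame_layer => j.
    rewrite subSS (coords_ptake k (Ordinal ml)) => ji.
    by rewrite mxE /= (_ : (j == _) = false) //; apply: ltn_eqF.
  move=> /(_ (Ordinal ml)); rewrite eS (coords_ptake k (Ordinal ml)) mxE !eqxx.
  by move=> /(_ (leqnn _)) /eqP; rewrite oner_eq0.
move=> S iS Si; have [[z Sz nz]|nS] :=
  pselect (exists2 z, act z x \in S & ~ vanish_below k (l.+1 - i) z).
- right=> y; apply/idP/idP => [/Si //|]; have [w ->] := gen y.
  move=> /mem_frame_layer; rewrite subSS => hw.
  have /mem_frame_layer := Si _ Sz; rewrite subSS => zi.
  apply: (left_ideal_above_leading (submod_left_ideal_above S)
    (i := Ordinal ml) Sz) => //.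
  apply/eqP => z0; apply: nz => j.
  rewrite eS ltnS leq_eqVlt => /orP[/eqP e|/zi //].
  by rewrite (_ : j = Ordinal ml) //; apply: val_inj.
- left=> y; apply/idP/idP => [Sy|/iS //]; have [w ew] := gen y.
  rewrite ew; apply/mem_frame_layer; apply: contra_notP nS => nw.
  by exists w; rewrite -?ew.
Qed.

Lemma frame_linear_image W (f : {linear U -> W}) : bijective f -> frame k (f x).
Proof.
move=> [g fK gK]; have [gen xL px] := xk; split=> [y|z z0|pf].
- by have [z ez] := gen (g y); exists z; rewrite -act_linear -ez gK.
- by rewrite -act_linear xL ?linear0.
- by apply: px; apply: (can_inj fK); rewrite act_linear pf linear0.
Qed.

End OneFrame.

Section LinearOf.
Variables (R : pzRingType) (U W : lmodType R) (f : U -> W).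
Hypothesis f_linear : linear f.

(** The alias carries the linearity proof, so that the structure can be
    inferred for it. *)
Definition linear_of of linear f := f.
HB.instance Definition _ :=
  GRing.isLinear.Build R U W _ (linear_of f_linear) f_linear.
Definition linear_fun : {linear U -> W} := linear_of f_linear.

End LinearOf.

Lemma lmod_iso_refl U : lmod_iso U U.
Proof. by exists idfun; exists idfun. Qed.

Lemma lmod_iso_sym U W : lmod_iso U W -> lmod_iso W U.
Proof.
move=> [f [g fK gK]]; have gl : linear g.
  by move=> a x y; apply: (can_inj fK); rewrite linearP !gK.
by exists (linear_fun gl); exists f.
Qed.

Lemma lmod_iso_trans U V W : lmod_iso U V -> lmod_iso V W -> lmod_iso U W.
Proof. by move=> [f bf] [g bg]; exists (g \o f); apply: bij_comp. Qed.

(** Both modules are cyclic, and the generators have the same annihilator. *)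
Lemma frame_iso U W k (x : U) (y : W) : frame k x -> frame k y -> lmod_iso U W.
Proof.
move=> xk yk; have [genx _ _] := xk; have [geny _ _] := yk.
have /choice[c hc] : forall u : U, exists z, u = act z x := genx.
have /choice[d hd] : forall u : W, exists z, u = act z y := geny.
have E z w : act z x = act w x <-> act z y = act w y.
  have eB (V : lmodType Lam) (v : V) : act z v = act w v <-> act (z - w) v = 0.
    by rewrite actBl; split=> [->|/eqP]; rewrite ?subrr // subr_eq0 => /eqP.
  by split=> /eB h; apply/eB;
    [apply/(frame_annihilator yk)/(frame_annihilator xk)
    |apply/(frame_annihilator xk)/(frame_annihilator yk)].
pose f u := act (c u) y.
have fE z : f (act z x) = act z y by apply/E; rewrite -hc.
have fl : linear f.
  move=> a u u'; have [b ->] := cls_surj a.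
  rewrite (hc u) (hc u') -[cls I b *: _]/(act b _) -actM -actDl !fE.
  by rewrite actDl actM.
exists (linear_fun fl); exists (fun v => act (d v) x) => u.
  by rewrite [RHS]hc; apply/E; rewrite -hd.
by rewrite [linear_fun fl _]fE -hd.
Qed.

End Frames.

(** * Points of a uniserial module *)

Section UniserialIndex.
Variables (R : pzRingType) (U : lmodType R) (n : nat).

(** The submodules of a uniserial module are the terms of its composition
    series, hence are measured by their index. *)
Lemma uniserial_index : uniserial U -> composition_length U n ->
  exists idx : submodClosed U -> nat,
    [/\ forall S, (idx S <= n)%N,
        forall S T : submodClosed U,
          {subset S <= T} -> ~ {subset T <= S} -> (idx S < idx T)%N,
        forall S, idx S = 0%N -> forall x, x \in S -> x = 0 &
        forall S, idx S = n -> forall x, x \in S].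
Proof.
move=> Uu [c [c0 cn cS]].
have term (W : submodClosed U) : exists i, (i <= n)%N /\ W =i c i.
  have H i : (i <= n)%N ->
      {subset c i <= W} \/ exists j, (j <= n)%N /\ W =i c j.
    elim: i => [_|i IH il].
      by left=> x; rewrite c0 inE => /eqP ->; apply: rpred0.
    have [cW|] := IH (ltnW il); last by right.
    have [?|Wc] := Uu (c i.+1) W; first by left.
    have [_ _ cov] := cS i il.
    by have [e|e] := cov W cW Wc; right; [exists i; rewrite ltnW|exists i.+1].
  have [cW|//] := H n (leqnn n); exists n; split=> // x.
  by rewrite cn; apply: cW; rewrite cn.
have mono i j : (i <= j)%N -> (j <= n)%N -> {subset c i <= c j}.
  move=> /subnKC <-; elim: (j - i)%N => [|m IH]; first by rewrite addn0 => _ x.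
  by rewrite addnS => mn x /(IH (ltnW mn)); have [cs _ _] := cS _ mn; apply: cs.
have /choice[idx hidx] := term.
exists idx; split=> [S|S T ST nTS|S S0 x|S Sn x].
- by have [] := hidx S.
- have [Sn eS] := hidx S; have [Tn eT] := hidx T.
  rewrite ltnNge; apply/negP => TS; apply: nTS => x.
  by rewrite eS eT; apply: mono.
- by have [_ ->] := hidx S; rewrite S0 c0 inE => /eqP.
- by have [_ ->] := hidx S; rewrite Sn cn.
Qed.

End UniserialIndex.

Section PointOfModule.
Variables (K : fieldType) (Gamma : quiver) (I : ideal (pathalg K Gamma)).
Hypothesis I_adm : admissible I.
Local Notation KG := (pathalg K Gamma).
Local Notation Lam := (quotring I).
Variable p : qpath Gamma.
Local Notation l := (plength p).
Local Notation v_ i := (pelt K (ptake i p)).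
Local Notation e1 := (pelt K (ptrivial (pstart p))).
Implicit Types (a : arrow Gamma) (q r : qpath Gamma) (z w : KG).

Lemma pelt_arrowM a q r : path_comp (parrow a) q = Some r ->
  pelt K r = pelt K (parrow a) * pelt K q.
Proof. by move=> aq; rewrite pelt_mul /pmul aq. Qed.

Lemma pelt_trivialM s q :
  pelt K (ptrivial s) * pelt K q = (s == pend q)%:R *: pelt K q.
Proof.
rewrite pelt_mul /pmul; have [->|ns] := eqVneq s (pend q).
  by rewrite path_comp1p scale1r.
by rewrite path_comp_None ?scale0r //; apply/eqP.
Qed.

Lemma pelt_Mtrivial s q :
  pelt K q * pelt K (ptrivial s) = (s == pstart q)%:R *: pelt K q.
Proof.
rewrite pelt_mul /pmul; have [->|ns] := eqVneq s (pstart q).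
  by rewrite path_compp1 scale1r.
by rewrite path_comp_None ?scale0r //=; apply/eqP; rewrite eq_sym.
Qed.

Section GivenGenerator.
Variables (U : lmodType Lam) (x : U).
Hypotheses (U_uniserial : uniserial U).
Hypothesis (U_length : composition_length U l.+1).
Hypotheses (px : act (pelt K p) x <> 0) (e1x : act e1 x = x).
Local Notation b i := (act (v_ i) x).

Definition cyclic_submod (y : U) : submodClosed U := lspan (fun u => u = y).

Lemma cyclic_submodP y u : u \in cyclic_submod y -> exists z, u = act z y.
Proof.
move: u; apply: lspan_ind => [|_ _ [z ->] [w ->]|a _ ->].
- by exists 0; rewrite act0.
- by exists (z + w); rewrite actDl.
- by have [z ->] := cls_surj a; exists z.
Qed.

Definition arrow_submod (y : U) : submodClosed U :=
  lspan (fun u => exists2 z, in_arrow_pow 1 z & u = act z y).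

Lemma arrow_submodP y u : u \in arrow_submod y ->
  exists2 z, in_arrow_pow 1 z & u = act z y.
Proof.
move: u; apply: lspan_ind => [|_ _ [z hz ->] [w hw ->]|a _ [w hw ->]].
- by exists 0; rewrite ?act0 //; apply: in_arrow_pow0.
- by exists (z + w); rewrite ?actDl //; apply: in_arrow_powD.
- have [z ->] := cls_surj a; exists (z * w); rewrite ?actM //.
  by rewrite -[1%N]add0n; apply: in_arrow_powM.
Qed.

(** An equation [y = z y] with [z] in the arrow ideal can be iterated, and a
    power of [z] lies in [I]. *)
Lemma arrow_submod_proper y : y \in arrow_submod y -> y = 0.
Proof.
move=> /arrow_submodP[z hz yz]; have [_ [m [_ hm]]] := I_adm.
have yX n : y = act (z ^+ n) y.
  by elim: n => [|n IH]; rewrite ?expr0 ?act1 // exprSr actM -yz.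
by rewrite (yX m) act_ideal //; apply/hm/in_arrow_powX.
Qed.

Lemma b_neq0 i : (i <= l)%N -> b i <> 0.
Proof.
move=> il bi; have [w pw] := long_path_factor K il.
by apply: px; rewrite pw actM bi raddf0.
Qed.

Lemma b_next i : (i < l)%N ->
  exists2 z, in_arrow_pow 1 z & b i.+1 = act z (b i).
Proof.
move=> il; have [a [_ ca]] := ptakeS il.
exists (pelt K (parrow a)); first exact: in_arrow_pow_pelt.
by rewrite (pelt_arrowM ca) actM.
Qed.

(** The chain of the cyclic submodules generated by [b 0], ..., [b l] is
    strict and has as many nonzero terms as the composition length allows. So
    it starts with the whole module, and nothing lies strictly between
    consecutive terms; but the image of the arrow ideal does lie there. *)
Lemma layers : [/\ forall y, exists z, y = act z x,
  forall i, (i < l)%N -> {subset arrow_submod (b i) <= cyclic_submod (b i.+1)} &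
  forall u, u \in arrow_submod (b l) -> u = 0].
Proof.
have [idx [idx_le idx_lt idx0 idxn]] := uniserial_index U_uniserial U_length.
pose n i := idx (cyclic_submod (b i)).
have TS i : {subset arrow_submod (b i) <= cyclic_submod (b i)}.
  by move=> u /arrow_submodP[z _ ->]; apply/act_mem/lspan_gen.
have nTS i : (i <= l)%N -> ~ {subset cyclic_submod (b i) <= arrow_submod (b i)}.
  move=> il /(_ (b i)) h; apply: (b_neq0 il); apply: arrow_submod_proper.
  by apply: h; apply: lspan_gen.
have nT i : (i <= l)%N -> (idx (arrow_submod (b i)) < n i)%N.
  by move=> il; apply: idx_lt (nTS _ il).
have ST i : (i < l)%N -> {subset cyclic_submod (b i.+1) <= arrow_submod (b i)}.
  move=> il u /cyclic_submodP[z ->]; apply: act_mem; apply: lspan_gen.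
  exact: b_next.
have nS i : (i < l)%N -> (n i.+1 < n i)%N.
  move=> il; apply: idx_lt => [u /(ST i il) /TS //|h].
  by apply: (nTS i (ltnW il)) => u /h /(ST i il).
(* The index drops at each step and is positive at the last one, but is at
   most [l.+1] at the first one; this determines all indices. *)
have lower m : (m <= l)%N -> (m < n (l - m))%N.
  elim: m => [_|m IH ml]; last first.
    apply: leq_ltn_trans (IH (ltnW ml)) _.
    rewrite -(subnSK ml); apply: nS.
    by rewrite ltn_subrL (leq_ltn_trans _ ml).
  by apply: leq_ltn_trans (nT (l - 0)%N _); rewrite ?subn0.
have upper i : (i <= l)%N -> (n i + i <= l.+1)%N.
  elim: i => [_|i IH il]; first by rewrite addn0 idx_le.
  by rewrite addnS; apply: leq_trans (IH (ltnW il)); rewrite ltn_add2r nS.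
have nE i : (i <= l)%N -> n i = (l.+1 - i)%N.
  move=> il; apply/eqP; rewrite eqn_leq leq_subRL ?(leqW il) // addnC upper //=.
  by have := lower (l - i)%N (leq_subr _ _); rewrite subKn // subSn.
split.
- move=> y; apply: cyclic_submodP.
  have -> : x = b 0 by rewrite ptake0 e1x.
  by apply: idxn; rewrite -/(n 0%N) nE.
- move=> i il; have [//|h] := U_uniserial (arrow_submod (b i))
    (cyclic_submod (b i.+1)).
  apply: contrapT => nh; have := idx_lt _ _ h nh; rewrite -/(n i.+1) nE //.
  rewrite subSS => h1; have := nT i (ltnW il); rewrite nE ?(ltnW il) //.
  by rewrite subSn ?(ltnW il) // ltnS leqNgt h1.
- apply: idx0; have := nT l (leqnn l); rewrite nE // subSn // subnn.
  by rewrite ltnS leqn0 => /eqP.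
Qed.

(** Paths of length [0] act on a path by [0] or [1]. *)
Lemma split_degree0 q z : exists d w,
  in_arrow_pow 1 w /\ z * pelt K q = d *: pelt K q + w * pelt K q.
Proof.
elim/pathalg_ind: z => [|z z' [d [w [hw e]]] [d' [w' [hw' e']]]|c r].
- exists 0, 0; split; first exact: in_arrow_pow0.
  by rewrite scale0r !mul0r addr0.
- exists (d + d'), (w + w'); split; first exact: in_arrow_powD.
  by rewrite !mulrDl e e' scalerDl addrACA.
have [r0|] := posnP (plength r); last first.
  move=> r1; exists 0, (c *: pelt K r); split; last by rewrite scale0r add0r.
  exact/in_arrow_powZ/in_arrow_pow_pelt.
have -> : r = ptrivial (pstart r) by apply: qpathP => //; apply/size0nil.
exists (c * (pstart r == pend q)%:R), 0; split; first exact: in_arrow_pow0.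
by rewrite mul0r addr0 -scalerAl pelt_trivialM scalerA.
Qed.

Lemma arrow_act_later i z : (i <= l)%N -> in_arrow_pow 1 z ->
  exists c : 'I_l.+1 -> K,
    act z (b i) = act (\sum_(j < l.+1 | (i < j)%N) c j *: v_ j) x.
Proof.
have [_ TS Tl] := layers.
move m: (l - i)%N => n; elim: n i m z => [|n IH] i li z il hz.
  have {1}-> : i = l by apply/eqP; rewrite eqn_leq il -subn_eq0 li.
  rewrite (Tl (act z (b l))); last by apply: lspan_gen; exists z.
  exists (fun=> 0); rewrite big1 ?act0 // => j _; exact: scale0r.
have il' : (i < l)%N by rewrite -subn_gt0 li.
have /(TS _ il')/cyclic_submodP[w ->] : act z (b i) \in arrow_submod (b i).
  by apply: lspan_gen; exists z.
have [d [w' [hw' e]]] := split_degree0 (ptake i.+1 p) w.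
have [|c hc] := IH i.+1 _ w' il' hw'; first by rewrite subnS li.
rewrite -actM e actDl actM hc -actDl.
exists (fun j : 'I_l.+1 => if j == i.+1 :> nat then d else c j); congr act.
have il1 : (i.+1 < l.+1)%N by [].
rewrite [RHS](bigD1 (Ordinal il1)) //= eqxx; congr (_ + _).
apply: eq_big => [j|j ij]; last by rewrite gtn_eqF.
by rewrite [RHS]andbC -(inj_eq val_inj) /= ltn_neqAle eq_sym.
Qed.

(** Only right subpaths with the endpoint of [a] remain after multiplication
    by the vertex at which [a] ends. *)
Lemma arrow_act_vertex a i : (i <= l)%N -> exists c : 'I_l.+1 -> K,
  act (pelt K (parrow a) * v_ i) x =
  act (\sum_(j < l.+1 | (i < j)%N && (subpath_end p j == atgt a))
         c j *: v_ j) x.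
Proof.
move=> il; have [|c hc] := arrow_act_later il (z := pelt K (parrow a)).
  exact: in_arrow_pow_pelt.
exists c; have {1}-> : pelt K (parrow a) =
    pelt K (ptrivial (atgt a)) * pelt K (parrow a).
  by rewrite pelt_trivialM eqxx scale1r.
rewrite -mulrA actM actM hc -actM; congr act.
rewrite mulr_sumr [RHS]big_mkcondr; apply: eq_bigr => j _.
rewrite -scalerAr pelt_trivialM eq_sym -/(subpath_end p j).
by case: eqP; rewrite ?scale1r // scale0r scaler0.
Qed.

(** The coefficients in [arrow_act_vertex] that belong to detours form the
    point. If [a] and [v_ i] form no detour and [a v_ i] is not a right
    subpath, then the sum is empty, so that [a v_ i] acts by zero. *)
Lemma exists_frame : exists k : point K p, frame k x.
Proof.
have /choice[c hc] : forall ai : arrow Gamma * 'I_l.+1, exists c : 'I_l.+1 -> K,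
    act (pelt K (parrow ai.1) * v_ ai.2) x =
    act (\sum_(j < l.+1 | (ai.2 < j)%N && (subpath_end p j == atgt ai.1))
       c j *: v_ j) x.
  by move=> [a i]; apply: arrow_act_vertex; rewrite leq_ord.
pose k : point K p :=
  [ffun y : dvar p => c ((val y).1.1, rsub_ord (val y).1.2) (dvar_ord y)].
exists k; have [gen _ _] := layers; split=> // z /eqP.
rewrite -mem_first_ideal /path_ideal; move: z.
apply: (lspan_ind (V := KG^o) (P := fun z : KG => act z x = 0)).
- exact: act0.
- by move=> z w hz hw; rewrite actDl hz hw addr0.
move=> w z hz; rewrite [w *: z]/(w * z) actM.
suff -> : act (z : KG) x = 0 by rewrite raddf0.
case: hz => [[q [[[s ns ->]|[a [i [il aq nq nd]]]] ->]]|[a [u [dau ->]]]].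
- by rewrite -e1x -actM pelt_trivialM (negPf ns) scale0r act0.
- rewrite (pelt_arrowM aq) (hc (a, Ordinal (il : (i < l.+1)%N))) /=.
  rewrite big1 ?act0 // => j /andP[ij /eqP ej]; case/negP: nd.
  rewrite /is_detour ptake_right_subpath aq nq /=.
  apply/existsP; exists (sub_at j).
  rewrite val_sub_at !plength_ptake ?leq_ord //.
  by rewrite addn1 ij; apply/eqP.
have [ru _] := detourP dau; have eu := right_subpath_ptake ru.
have ul : (plength u < l.+1)%N by rewrite ltnS right_subpath_plength.
pose i := Ordinal ul; rewrite /detour_elt actBl {1}eu (hc (a, i)) -actBl /=.
rewrite (_ : _ - _ = 0) ?act0 //; apply/eqP; rewrite subr_eq0; apply/eqP.
rewrite [RHS](partition_big (@dvar_ord _ p) (fun j : 'I_l.+1 =>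
  (i < j)%N && (subpath_end p j == atgt a))) /=; last first.
  move=> y /eqP dy; have [_ + +] := dvarE y.
  rewrite dy /= dvar_pathE plength_ptake ?leq_ord // => -> <-.
  exact: eqxx.
apply: eq_bigr => j /andP[ij /eqP ej].
have dai : is_detour p a (ptake i p) by rewrite -eu.
have [y [dy py]] := dvarP dai ij ej.
have yj : dvar_ord y = j by apply/eqP; rewrite -dvar_path_eq py.
rewrite (big_pred1 y) => [|y']; last first.
  apply/andP/eqP => [[/eqP dy' /eqP yj']|->].
    by apply: dvar_inj; [rewrite dy' dy -eu|rewrite !dvar_pathE yj' yj].
  by rewrite dy yj -eu !eqxx.
rewrite py /k ffunE yj; congr (c (_, _) _ *: _).
  by rewrite -[RHS]/((dvar_detour y).1) dy.
by apply: val_inj; rewrite /= -[RHS]/(plength (dvar_detour y).2) dy /= -eu.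
Qed.

End GivenGenerator.

Lemma uniserial_frame (U : lmodType Lam) : uniserial U -> has_mast p U ->
  exists (k : point K p) (x : U), frame k x.
Proof.
move=> Uu [Ul [x px]]; suff [k hk] : exists k : point K p, frame k (act e1 x).
  by exists k, (act e1 x).
apply: exists_frame => //.
  by rewrite -actM pelt_Mtrivial eqxx scale1r.
by rewrite -actM pelt_Mtrivial /= eqxx scale1r.
Qed.

End PointOfModule.

(** * Quotients of the projective module *)

Section QuotientFrames.
Variables (K : fieldType) (Gamma : quiver) (I : ideal (pathalg K Gamma)).
Local Notation KG := (pathalg K Gamma).
Local Notation Lam := (quotring I).
Variable p : qpath Gamma.
Local Notation l := (plength p).
Local Notation v_ i := (pelt K (ptake i p)).
Local Notation e1 := (pelt K (ptrivial (pstart p))).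
Implicit Types (a : arrow Gamma) (q r : qpath Gamma) (z w : KG) (k : point K p).

Lemma coords1 k : coords k 1 = delta_mx 0 0.
Proof.
rewrite -[1]/(pa_one K Gamma) /pa_one raddf_sum (bigD1 (pstart p)) //=.
rewrite big1 => [|s sp]; rewrite coords_trivial.
  by rewrite eqxx scale1r addr0.
by rewrite eq_sym (negPf sp) scale0r.
Qed.

Lemma coords_start k : coords k e1 = coords k 1.
Proof. by rewrite coords1 coords_trivial eqxx scale1r. Qed.

Lemma coordsM_start k z : coords k (z * e1) = coords k z.
Proof. by rewrite coordsM coords_start -coordsM mulr1. Qed.

Definition qproj (M : lmodType Lam) (S : submodClosed M) (x : M) : quotmod S :=
  \pi_(quotmod S)%qT x.

Lemma qproj_act (M : lmodType Lam) (S : submodClosed M) z (x : M) :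
  act z (qproj S x) = qproj S (act z x).
Proof. by rewrite /qproj /act pi_scale. Qed.

Lemma qproj_eq0 (M : lmodType Lam) (S : submodClosed M) (x : M) :
  qproj S x = 0 <-> x \in S.
Proof.
have -> : (0 : quotmod S) = qproj S 0.
  by have := qproj_act S 0 0; rewrite !act0.
by rewrite -[X in X \in S]subr0 quotmodP; split=> /eqP.
Qed.

Lemma qproj_surj (M : lmodType Lam) (S : submodClosed M) (y : quotmod S) :
  exists x, y = qproj S x.
Proof. by exists (repr y); rewrite /qproj reprK. Qed.

Lemma qproj_generates (M : lmodType Lam) (S : submodClosed M) (x : M) :
  (forall y : M, exists z, y = act z x) ->
  forall y : quotmod S, exists z, y = act z (qproj S x).
Proof.
move=> gen y; have [u ->] := qproj_surj y; have [z ->] := gen u.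
by exists z; rewrite qproj_act.
Qed.

Lemma quot_frame (M : lmodType Lam) (S : submodClosed M) (x : M) k :
  (forall y : M, exists z, y = act z x) ->
  (forall z, act z x \in S <-> coords k z = 0) -> frame k (qproj S x).
Proof.
move=> gen xS; split; first exact: qproj_generates.
  by move=> z /xS zS; rewrite qproj_act; apply/qproj_eq0.
rewrite qproj_act => /qproj_eq0 /xS; rewrite coords_whole_path.
by move/rowP/(_ ord_max)/eqP; rewrite !mxE !eqxx oner_eq0.
Qed.

Definition start_elt : Lame1 p I :=
  exist _ (cls I e1)
    (lspan_gen (V := Lam^o) (S := fun x => x = cls I e1) erefl).

Lemma val_act_start z : val (act z start_elt) = cls I (z * e1).
Proof. by rewrite clsM. Qed.

Lemma start_generates (y : Lame1 p I) : exists z, y = act z start_elt.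
Proof.
suff [z ez] : exists z, val y = cls I (z * e1).
  by exists z; apply: val_inj; rewrite val_act_start.
have := valP y; move: (val y); apply: lspan_ind.
- by exists 0; rewrite mul0r raddf0.
- by move=> _ _ [z ->] [w ->]; exists (z + w); rewrite mulrDl raddfD.
- by move=> a _ ->; have [z ->] := cls_surj a; exists z; rewrite clsM.
Qed.

Lemma act_start_eqP z (y : Lame1 p I) :
  val y = cls I (z * e1) -> y = act z start_elt.
Proof. by move=> e; apply: val_inj; rewrite val_act_start. Qed.

Lemma act_detour_start k a u : is_detour p a u ->
  val (act (detour_elt k a u) start_elt) = cls I (detour_elt k a u).
Proof.
move=> dau; rewrite val_act_start; congr cls.
have [/andP[/eqP su _] _] := detourP dau.
rewrite /detour_elt mulrBl -mulrA pelt_Mtrivial su eqxx scale1r; congr (_ - _).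
rewrite mulr_suml; apply: eq_bigr => x _; rewrite -scalerAl pelt_Mtrivial.
have /andP[/eqP -> _] := rsub_right_subpath (val x).2.
by rewrite eqxx scale1r.
Qed.

Section GivenPoint.
Variable k : point K p.
Hypothesis Ik : forall z, z \in I -> coords k z = 0.

Lemma act_start0 z : act z start_elt = 0 -> coords k z = 0.
Proof.
move/(congr1 val); rewrite val_act_start => /eqP; rewrite cls_eq0 => /Ik.
by rewrite coordsM_start.
Qed.

(** The factor module of [Lame1 p I] by [U_submod I k] is thus the
    representation attached to [k]; that [I] acts by zero on the latter is used
    for passing from residue classes back to the path algebra. *)
Lemma mem_U_submod z : act z start_elt \in U_submod I k <-> coords k z = 0.
Proof.
split=> [zU|/eqP].
  suff [w ew w0] :
      exists2 w, act z start_elt = act w start_elt & coords k w = 0.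
    move: ew => /eqP; rewrite -subr_eq0 -actBl => /eqP /act_start0.
    by rewrite raddfB /= w0 subr0.
  move: (act z start_elt) zU; apply: lspan_ind.
  - by exists 0; rewrite ?act0 // raddf0.
  - move=> _ _ [w -> w0] [w' -> w0']; exists (w + w'); first by rewrite actDl.
    by rewrite raddfD /= w0 w0' addr0.
  move=> a y hy; have [b ->] := cls_surj a.
  suff [w -> w0] : exists2 w, y = act w start_elt & coords k w = 0.
    by exists (b * w); rewrite ?actM // coordsM w0 mul0mx.
  case: hy => [[a' [u [dau ey]]]|[q [nq ey]]]; last first.
    by exists (pelt K q); [apply: act_start_eqP | apply: coords_nonroute].
  exists (detour_elt k a' u); last exact: coords_detour_elt.
  by apply: val_inj; rewrite ey act_detour_start.
rewrite -mem_point_ideal /point_ideal /path_ideal; move: z.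
apply: (lspan_ind (V := KG^o)
  (P := fun z : KG => act z start_elt \in U_submod I k)).
- by rewrite act0 rpred0.
- by move=> z w hz hw; rewrite actDl; apply: rpredD.
move=> w z hz; rewrite [w *: z]/(w * z) actM; apply/act_mem/lspan_gen.
case: hz => [[q [nq ->]]|[a [u [dau ->]]]]; [right|left].
  by exists q; rewrite val_act_start.
by exists a, u; rewrite act_detour_start.
Qed.

Lemma U_frame : frame k (qproj (U_submod I k) start_elt).
Proof. apply: quot_frame; [exact: start_generates | exact: mem_U_submod]. Qed.

Local Notation D := (quotmod (detour_submod I k)).
Local Notation dgen := (qproj (detour_submod I k) start_elt).

Lemma detour_submod_sub : {subset detour_submod I k <= U_submod I k}.
Proof. by apply: lspan_sub => x hx; apply: lspan_gen; left. Qed.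

(** The image of [U_submod I k], described without reference to it. *)
Definition mast_submod : submodClosed D :=
  lspan (fun y => exists2 z, coords k z = 0 & y = act z dgen).

Lemma mem_mast_submod z : act z dgen \in mast_submod <-> coords k z = 0.
Proof.
split=> [zU|z0]; last by apply: lspan_gen; exists z.
suff [w ew w0] : exists2 w, act z dgen = act w dgen & coords k w = 0.
  move: ew => /eqP; rewrite -subr_eq0 -actBl qproj_act => /eqP /qproj_eq0.
  by move=> /detour_submod_sub /mem_U_submod; rewrite raddfB /= w0 subr0.
move: (act z dgen) zU; apply: lspan_ind.
- by exists 0; rewrite ?act0 // raddf0.
- move=> _ _ [w -> w0] [w' -> w0']; exists (w + w'); first by rewrite actDl.
  by rewrite raddfD /= w0 w0' addr0.
move=> a _ [w w0 ->]; have [b ->] := cls_surj a.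
by exists (b * w); rewrite ?actM // coordsM w0 mul0mx.
Qed.

Lemma dgen_generates (y : D) : exists z, y = act z dgen.
Proof. exact: (qproj_generates start_generates). Qed.

Lemma mast_frame : frame k (qproj mast_submod dgen).
Proof. apply: quot_frame; [exact: dgen_generates | exact: mem_mast_submod]. Qed.

End GivenPoint.

Lemma coords_whole_pathM k z :
  coords k (pelt K p * z) = coords k z 0 0 *: delta_mx 0 ord_max.
Proof.
have p0 (m j : 'I_l.+1) : (j < m + l)%N -> path_mx k p m j = 0.
  exact: path_mx_shift.
apply/rowP => j; rewrite coordsM repr_mx_pelt mxE (bigD1 0) //= [RHS]mxE.
rewrite big1 => [|m m0]; last first.
  rewrite p0 ?mulr0 // (leq_ltn_trans (leq_ord j)) // -{1}[l]add0n ltn_add2r.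
  by rewrite lt0n.
rewrite addr0; congr (_ * _).
by have /rowP/(_ j) := coords_whole_path k; rewrite /coords repr_mx_pelt mxE.
Qed.

(** Otherwise the coordinate of [y] at the path of length [0] vanishes, since
    [p] shifts it to the last position; but then no multiple of [y] has a
    nonzero coordinate there, and [y] does not generate [x]. *)
Lemma frame_generator (U : lmodType Lam) k (x y : U) : frame k x ->
  (forall u : U, exists z, u = act z y) -> act (pelt K p) y <> 0.
Proof.
move=> xk gen; have [genx _ _] := xk; have [z ez] := genx y.
rewrite ez -actM => /(frame_annihilator xk).
rewrite coords_whole_pathM => /rowP/(_ ord_max).
rewrite [LHS]mxE [X in _ * X]mxE [RHS]mxE !eqxx mulr1 => z00.
have [w ew] := gen x.
have /(frame_annihilator xk) : act (1 - w * z) x = 0.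
  by rewrite actBl act1 actM -ez -ew subrr.
rewrite raddfB /= coords1 => /eqP; rewrite subr_eq0 => /eqP/rowP/(_ 0).
rewrite [LHS]mxE !eqxx (vanish_belowM (n := 1)) //; last first.
  move=> j; rewrite ltnS leqn0 => /eqP j0.
  by rewrite (_ : j = 0) //; apply: val_inj.
by move/eqP; rewrite oner_eq0.
Qed.

Lemma frame_start (U : lmodType Lam) k (x : U) : frame k x -> act e1 x = x.
Proof.
move=> [_ xL _]; apply/eqP; rewrite -subr_eq0 -{2}[x]act1 -actBl.
by rewrite xL // raddfB /= coords_start subrr.
Qed.

(** Both generators lie over the starting vertex, where the coordinates are
    those at the path of length [0] and possibly at [p]. So they are
    proportional up to the socle, which every arrow kills, and they satisfy
    the same relations. *)
Lemma frame_point_inj (U : lmodType Lam) k k' (x x' : U) :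
  (forall i, (0 < i < l)%N -> subpath_end p i != pstart p) ->
  frame k x -> frame k' x' -> k = k'.
Proof.
move=> nocycle xk xk'; apply/ffunP => y.
have [genx _ _] := xk; have [z ez] := genx x'.
have {ez} ez : x' = act (e1 * z) x by rewrite actM -ez (frame_start xk').
set z' := e1 * z in ez.
have z'0 (j : 'I_l.+1) : (0 < j < l)%N -> coords k z' 0 j = 0.
  by move=> jl; rewrite coords_pend mxE (negPf (nocycle j jl)) mul0r.
have c0 : coords k z' 0 0 != 0.
  apply/eqP => c0; have [_ _] := xk'; apply.
  rewrite ez -actM; apply/(frame_annihilator xk).
  by rewrite coords_whole_pathM c0 scale0r.
(* The remaining coordinate of [z'] is the one at [p], which arrows kill. *)
have later w : in_arrow_pow 1 w ->
    coords k (w * z') = coords k z' 0 0 *: coords k w.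
  move=> hw; apply/rowP => j; rewrite coordsM mxE (bigD1 0) //= big1 => [|m m0].
    by rewrite addr0 [RHS]mxE [coords k w]/(row 0 _) [row 0 _ 0 j]mxE.
  have [ml|lm] := ltnP m l; first by rewrite z'0 ?mul0r // ml lt0n m0.
  by rewrite (repr_mx_strict _ hw) ?mulr0 // (leq_trans (leq_ord j)).
pose a := (dvar_detour y).1; pose u := (dvar_detour y).2.
have [dau _ _] := dvarE y; rewrite -/a -/u in dau.
have hD : in_arrow_pow 1 (detour_elt k' a u).
  apply: in_arrow_powD; first rewrite -[1%N]addn0; first apply: in_arrow_powM.
  - exact: in_arrow_pow_pelt.
  - by move=> q.
  rewrite -sumrN; apply: in_arrow_pow_sum => t _; rewrite -scaleNr.
  apply/in_arrow_powZ/in_arrow_pow_pelt.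
  by have [_ lt _] := dvarE t; apply: leq_ltn_trans lt.
have D0 : coords k (detour_elt k' a u) = 0.
  apply/eqP; rewrite -(inj_eq (scalerI c0)) scaler0 -(later _ hD); apply/eqP.
  apply/(frame_annihilator xk); rewrite actM -ez.
  by have [_ h _] := xk'; apply: h; apply: coords_detour_elt.
have S (c : point K p) : coords k (detour_elt c a u) 0 (dvar_ord y) =
    coords k (pelt K (parrow a) * pelt K u) 0 (dvar_ord y) - c y.
  rewrite raddfB /= mxE [X in _ + X]mxE coords_dvar_sum; congr (_ - _).
  rewrite (big_pred1 y) // => t; rewrite dvar_path_eq.
  apply/andP/eqP => [[/eqP dt /eqP ty]|->]; last first.
    by split; rewrite // /a /u -surjective_pairing.
  apply: dvar_inj; last by rewrite !dvar_pathE ty.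
  by rewrite dt /a /u -surjective_pairing.
apply: oppr_inj.
apply: (addrI (coords k (pelt K (parrow a) * pelt K u) 0 (dvar_ord y))).
by rewrite -!S D0 coords_detour_elt.
Qed.

Lemma frame_of_relations (U : lmodType Lam) k (y : U) :
  (forall u : U, exists z, u = act z y) -> act (pelt K p) y <> 0 ->
  (forall q, ~~ is_route p q -> act (pelt K q) y = 0) ->
  (forall a u, is_detour p a u -> act (detour_elt k a u) y = 0) -> frame k y.
Proof.
move=> gen py nonr det; split=> // z /eqP.
rewrite -mem_point_ideal /point_ideal /path_ideal; move: z.
apply: (lspan_ind (V := KG^o) (P := fun z : KG => act z y = 0)).
- exact: act0.
- by move=> z w hz hw; rewrite actDl hz hw addr0.
move=> w z hz; rewrite [w *: z]/(w * z) actM.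
suff -> : act (z : KG) y = 0 by rewrite raddf0.
by case: hz => [[q [nq ->]]|[a [u [dau ->]]]]; [apply: nonr|apply: det].
Qed.

Hypothesis I_adm : admissible I.

(** The class of the starting vertex generates the factor module and is not
    killed by [p], hence is a frame at some point [k']. So it is killed by the
    non-routes; as it also satisfies the detour relations at [k], it is a frame
    at [k], and its annihilator determines [W']. *)
Lemma mast_submod_unique k : (forall z, z \in I -> coords k z = 0) ->
  forall W' : submodClosed (quotmod (detour_submod I k)),
    uniserial (quotmod W') -> has_mast p (quotmod W') -> W' =i mast_submod k.
Proof.
move=> Ik W' Wu Wm.
set d := qproj (detour_submod I k) start_elt; pose y := qproj W' d.
have geny : forall u : quotmod W', exists z, u = act z y.
  exact/qproj_generates/dgen_generates.
have [k0 [x0 xk0]] := uniserial_frame I_adm Wu Wm.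
have py : act (pelt K p) y <> 0 := frame_generator xk0 geny.
have [Wl _] := Wm.
have e1y : act e1 y = y.
  rewrite /y !qproj_act; congr (qproj _ (qproj _ _)); apply: val_inj.
  by rewrite val_act_start pelt_Mtrivial /= eqxx scale1r.
have [k' yk'] := exists_frame I_adm Wu Wl py e1y.
have yk : frame k y.
  apply: frame_of_relations => // [q nq|a u dau].
    by have [_ h _] := yk'; apply: h; apply: coords_nonroute.
  rewrite /y qproj_act /d qproj_act.
  rewrite (_ : qproj (detour_submod I k) _ = 0); first exact/qproj_eq0/rpred0.
  apply/qproj_eq0/lspan_gen; exists a, u; split=> //.
  exact: act_detour_start.
move=> w; have [z ->] := dgen_generates w; rewrite -/d.
apply/idP/idP => [zW|/(mem_mast_submod Ik) z0].
  apply/(mem_mast_submod Ik)/(frame_annihilator yk).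
  by rewrite /y qproj_act; apply/qproj_eq0.
apply/qproj_eq0; rewrite -qproj_act -/y.
exact/(frame_annihilator yk).
Qed.

End QuotientFrames.

Lemma no_cycle_subpath_end (Gamma : quiver) (p : qpath Gamma) :
  ~ (exists p' c, [/\ path_comp p' c = Some p, oriented_cycle c,
                     (0 < plength p')%N & (0 < plength c)%N]) ->
  forall i, (0 < i < plength p)%N -> subpath_end p i != pstart p.
Proof.
move=> nc i /andP[i0 il]; apply/eqP => e; apply: nc.
have /right_subpathP[w cw] := ptake_right_subpath p i.
exists w, (ptake i p); rewrite plength_ptake ?(ltnW il) //; split=> //.
  exact/eqP/esym.
have := path_comp_plength cw; rewrite plength_ptake ?(ltnW il) // => el.
by move: il; rewrite {1}el -{1}[i]add0n ltn_add2r.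
Qed.

Theorem theoremA (K : fieldType) (Gamma : quiver)
    (I : ideal (pathalg K Gamma)) (I_adm : admissible I)
    (L : nat) (L_loewy : loewy_length (quotring I) L)
    (p : qpath Gamma)
    (ts : seq (pathalg K Gamma))
    (ts_spans : forall z : pathalg K Gamma,
       z \in lspan (R := K) (fun t => t \in ts) <-> low_part I L z) :
  exists Phi : {k : point K p | variety ts k} -> uniserial_types I p,
    [/\ (* (I) *)
        (forall k, sval (Phi k) = lmod_iso (quotmod (U_submod I (sval k)))) /\
        (forall C, exists k, Phi k = C),
        (* (I), alternate description *)
        forall k : {k : point K p | variety ts k},
          exists W : submodClosed (quotmod (detour_submod I (sval k))),
            [/\ uniserial (quotmod W), has_mast p (quotmod W),
                lmod_iso (quotmod W) (quotmod (U_submod I (sval k))) &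
                forall W' : submodClosed (quotmod (detour_submod I (sval k))),
                  uniserial (quotmod W') -> has_mast p (quotmod W') ->
                  W' =i W],
        (* (II) *)
        (exists k : point K p, variety ts k) <->
        (exists U : lmodType (quotring I), uniserial U /\ has_mast p U),
        (* (III) *)
        ~ (exists v, [/\ right_subpath v p, (plength v < plength p)%N,
                         (0 < plength v)%N & oriented_cycle v]) ->
        bijective Phi &
        (* (III), stronger form *)
        ~ (exists p' c, [/\ path_comp p' c = Some p, oriented_cycle c,
                            (0 < plength p')%N & (0 < plength c)%N]) ->
        bijective Phi].
Proof.
have varP (k : point K p) := varietyP I_adm L_loewy ts_spans k.
have frame_var (U : lmodType (quotring I)) (k : point K p) (x : U) :
    frame k x -> variety ts k.
  move=> xk; apply/varP => z zI; apply/(frame_annihilator xk).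
  exact: act_ideal.
pose x (k : point K p) := qproj (U_submod I k) (start_elt I p).
have xk (k : point K p) : variety ts k -> frame k (x k).
  by move=> /varP Ik; apply: U_frame.
have PhiP (k : {k : point K p | variety ts k}) :
    exists U : lmodType (quotring I), [/\ uniserial U, has_mast p U &
      lmod_iso (quotmod (U_submod I (sval k))) = lmod_iso U].
  exists (quotmod (U_submod I (sval k))); have h := xk _ (svalP k).
  by split; [apply: frame_uniserial h|apply: frame_has_mast h|].
pose Phi k : uniserial_types I p := exist _ _ (PhiP k).
have iso_eq (U W : lmodType (quotring I)) :
    lmod_iso U W -> lmod_iso U = lmod_iso W.
  move=> UW; apply/funext => V; apply/propext; split.
    exact/lmod_iso_trans/lmod_iso_sym.
  exact: lmod_iso_trans.
have surj C : exists k, Phi k = C.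
  case: C => C hC; have [U [Uu Um eC]] := hC.
  have [k [y yk]] := uniserial_frame I_adm Uu Um.
  have vk := frame_var _ _ _ yk; exists (exist _ k vk).
  apply: eq_exist; rewrite /= eC; apply: iso_eq.
  exact: frame_iso (xk k vk) yk.
have bij : ~ (exists p' c, [/\ path_comp p' c = Some p, oriented_cycle c,
    (0 < plength p')%N & (0 < plength c)%N]) -> bijective Phi.
  move=> nc; have inj : injective Phi.
    move=> [k vk] [k' vk'] /(congr1 sval) /= e; apply: eq_exist => /=.
    have [f bf] : lmod_iso (quotmod (U_submod I k)) (quotmod (U_submod I k')).
      by rewrite e; apply: lmod_iso_refl.
    apply: (frame_point_inj (no_cycle_subpath_end nc) _ (xk k' vk')).
    exact: (frame_linear_image (xk k vk) bf).
  have /choice[g gK] := surj; exists g => // k.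
  exact: inj.
exists Phi; split=> //.
- move=> [k vk] /=; have /varP Ik := vk; exists (mast_submod I k).
  have fk := mast_frame Ik; split.
  + exact: frame_uniserial fk.
  + exact: frame_has_mast fk.
  + exact: frame_iso fk (xk k vk).
  + exact: mast_submod_unique.
- split=> [[k vk]|[U [Uu Um]]].
    exists (quotmod (U_submod I k)); have h := xk _ vk.
    by split; [apply: frame_uniserial h|apply: frame_has_mast h].
  have [k [y yk]] := uniserial_frame I_adm Uu Um.
  by exists k; apply: frame_var yk.
- move=> nc; apply: bij => -[p' [c [cp cc p'0 c0]]]; apply: nc; exists c.
  split=> //; first by apply/right_subpathP; exists p'.
  by rewrite (path_comp_plength cp) -{1}[plength c]add0n ltn_add2r.
Qed.
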